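(* Let $A$ be a Cohen-Macaulay ring and $I$ an ideal of $A$. Then the ideal $r(I,-)$ is an invariant on canonical $A$-modules; that is, if $\omega^1_A$ and $\omega^2_A$ are any two canonical $A$-modules, then $r(I,\omega^1_A)=r(I,\omega^2_A)$.
   Context: All rings are commutative Noetherian with unity and all modules are finitely generated. A canonical module of a Cohen-Macaulay ring $A$ is a finitely generated $A$-module $\omega_A$ such that $(\omega_A)_{\mathfrak m}$ is a canonical module of the local ring $A_{\mathfrak m}$ for every maximal ideal $\mathfrak m$. For an ideal $I$ and an $A$-module $M$, $r(I,M)=\bigcup_{k\ge 0}(I^{k+1}M:_A I^kM)\subseteq A$ (the stable value of an ascending chain of ideals). *)

(* Defs.v *)
From HB Require Import structures.
From mathcomp Require Import all_boot all_order all_algebra.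
From mathcomp Require Import generic_quotient ring_quotient.
From mathcomp Require Import boolp classical_sets ring.

Set Implicit Arguments.
Unset Strict Implicit.
Unset Printing Implicit Defensive.

Import GRing.Theory.
Local Open Scope classical_set_scope.
Local Open Scope ring_scope.
Local Open Scope quotient_scope.

(* Rings are [comPzRingType]s, so the zero ring is allowed.  Submodules of M
   are classical sets; an ideal of R is a submodule of R^o. *)

Section Submodules.
Variables (R : comPzRingType) (M : lmodType R).

Definition is_submodule (N : set M) : Prop :=
  GRing.submod_closed (fun u : M => u \in N).

(* the finite sums of products a *: u with a in I and u in N *)
Definition smul (I : set R) (N : set M) : set M :=
  [set x | exists n (a : 'I_n -> R) (u : 'I_n -> M),
     [/\ forall i, I (a i), forall i, N (u i) & x = \sum_(i < n) a i *: u i]].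

Definition span (X : set M) : set M := smul setT X.

Definition fin_gen : Prop := exists s : seq M, span [set` s] = setT.

(* the ideal N :_R N' *)
Definition colon (N N' : set M) : set R :=
  [set a | forall u, N' u -> N (a *: u)].

Definition annihilator : set R := colon [set 0] setT.

Definition trivial_module : Prop := forall u : M, u = 0.

End Submodules.

Arguments fin_gen {R} M.
Arguments annihilator {R} M.
Arguments trivial_module {R} M.

Section Ideals.
Variable R : comPzRingType.

Definition is_ideal (I : set R) : Prop := @is_submodule R R^o I.

Definition noetherian : Prop :=
  forall I : set R, is_ideal I -> exists s : seq R, I = @span R R^o [set` s].

Fixpoint ideal_exp (I : set R) (k : nat) : set R :=
  if k is k'.+1 then @smul R R^o I (ideal_exp I k') else setT.

Definition is_prime (p : set R) : Prop :=
  [/\ is_ideal p, ~ p 1 & forall a b, p (a * b) -> p a \/ p b].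

Definition is_maximal (m : set R) : Prop :=
  [/\ is_ideal m, ~ m 1 &
      forall J : set R, is_ideal J -> ~ J 1 -> m `<=` J -> J = m].

Definition local_ring (m : set R) : Prop :=
  is_maximal m /\ forall m' : set R, is_maximal m' -> m' = m.

Lemma maximal_ideal (m : set R) : is_maximal m -> is_ideal m.
Proof. by case. Qed.

Lemma maximal_prime (m : set R) : is_maximal m -> is_prime m.
Proof.
move=> [hm m1 mmax]; split=> // a b mab; apply: contrapT => /not_orP[ma mb].
case: (hm) => m0 mlin.
pose J : set R := [set x | exists r y, m y /\ x = r * a + y].
have hJ : is_ideal J.
  split; first by rewrite inE; exists 0, 0; rewrite mul0r addr0; split=> //;
    move: m0; rewrite inE.
  move=> c x y; rewrite !inE => -[r [u [mu ->]]] [s [v [mv ->]]].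
  exists (c * r + s), (c * u + v); split.
    by have := mlin c u v; rewrite !inE; apply.
  by rewrite /GRing.scale/= !mulrDr mulrDl addrACA !mulrA.
have mJ : m `<=` J by move=> y my; exists 0, y; rewrite mul0r add0r.
have [J1|J1] := pselect (J 1); last first.
  apply: ma; rewrite -(mmax J hJ J1 mJ); exists 1, 0; rewrite mul1r addr0.
  by split=> //; move: m0; rewrite inE.
case: J1 => r [y [my E]]; apply: mb.
have -> : b = r *: (a * b : R^o) + (b *: (y : R^o) + 0).
  rewrite addr0 /GRing.scale/= [b * y]mulrC mulrA -mulrDl -E mul1r //.
have m0' : m 0 by move: m0; rewrite inE.
have := mlin r (a * b) (b *: (y : R^o) + 0); rewrite !inE; apply=> //.
by have := mlin b y 0; rewrite !inE; apply.
Qed.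

End Ideals.

Section QuotientModule.
Variables (R : comPzRingType) (M : lmodType R) (N : set M).

Definition submodule_pred (_ : is_submodule N) : {pred M} :=
  fun u => u \in N.

Variable hN : is_submodule N.

HB.instance Definition _ :=
  GRing.isSubmodClosed.Build R M (submodule_pred hN) (GRing.submod_closed_semi hN).

(* M / N *)
Definition quotient_module : Type := Quotient.quot (submodule_pred hN).

HB.instance Definition _ := GRing.Zmodule.on quotient_module.
HB.instance Definition _ := @EqQuotient.on quotient_module.

Definition quot_scale (a : R) := lift_op1 quotient_module (fun u : M => a *: u).

Lemma pi_quotD (u v : M) :
  \pi_quotient_module (u + v) = \pi_quotient_module u + \pi_quotient_module v.
Proof. exact: (@Quotient.pi_add M (submodule_pred hN) u v). Qed.

Lemma quot_scale_pi (a : R) (u : M) :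
  quot_scale a (\pi u) = \pi_quotient_module (a *: u).
Proof.
unlock quot_scale; apply/eqP; rewrite -Quotient.idealrBE -scalerBr rpredZ //.
by rewrite Quotient.idealrBE reprK.
Qed.

Lemma quot_scaleA a b x : quot_scale a (quot_scale b x) = quot_scale (a * b) x.
Proof. by elim/quotW: x => u; rewrite !quot_scale_pi scalerA. Qed.

Lemma quot_scale1 : left_id 1 quot_scale.
Proof. by elim/quotW=> u; rewrite quot_scale_pi scale1r. Qed.

Lemma quot_scaleDr : right_distributive quot_scale +%R.
Proof.
move=> a; elim/quotW=> u; elim/quotW=> v.
by rewrite -pi_quotD !quot_scale_pi -pi_quotD scalerDr.
Qed.

Lemma quot_scaleDl x : {morph quot_scale^~ x : a b / a + b}.
Proof.
by move=> a b; elim/quotW: x => u; rewrite !quot_scale_pi -pi_quotD scalerDl.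
Qed.

HB.instance Definition _ := GRing.Zmodule_isLmodule.Build R quotient_module
  quot_scaleA quot_scale1 quot_scaleDr quot_scaleDl.

End QuotientModule.

Definition residue_field (R : comPzRingType) (m : set R) (hm : is_maximal m) :
  lmodType R := @quotient_module R R^o m (maximal_ideal hm).

Section Fractions.
Variables (R : comPzRingType) (S : mulrClosed R).

Definition denom : Type := {s : R | s \in S}.
HB.instance Definition _ := Choice.on denom.

Lemma denomP (s : denom) : sval s \in S. Proof. exact: (valP s). Qed.

Definition denom1 : denom := exist _ 1 (rpred1 S).
Definition denomM (s t : denom) : denom :=
  exist _ (sval s * sval t) (rpredM (denomP s) (denomP t)).

Variable M : lmodType R.

(* the pair (u, s) stands for the fraction u / s *)
Definition frac : Type := M * denom.
HB.instance Definition _ := Choice.on frac.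

Definition frac_eq (x y : frac) : bool :=
  `[< exists2 t : R, t \in S &
      (t * sval y.2) *: x.1 = (t * sval x.2) *: y.1 >].

Lemma frac_eq_refl : reflexive frac_eq.
Proof. by move=> x; apply/asboolP; exists 1; rewrite ?rpred1. Qed.

Lemma frac_eq_sym : symmetric frac_eq.
Proof. by move=> x y; apply/asboolP/asboolP => -[t St E]; exists t. Qed.

Lemma frac_eq_trans : transitive frac_eq.
Proof.
move=> [v s] [u r] [w q] /asboolP[t St /= E] /asboolP[t' St' /= E'].
apply/asboolP; exists (t * t' * sval s); first by rewrite !rpredM ?denomP.
have -> : t * t' * sval s * sval q = (t' * sval q) * (t * sval s) by ring.
rewrite -scalerA /= E scalerA.
have -> : (t' * sval q) * (t * sval r) = (t * sval r) * (t' * sval q) by ring.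
by rewrite -scalerA E' scalerA /=; congr (_ *: _); ring.
Qed.

Canonical frac_equiv :=
  EquivRel frac_eq frac_eq_refl frac_eq_sym frac_eq_trans.

Definition frac_add (x y : frac) : frac :=
  (sval y.2 *: x.1 + sval x.2 *: y.1, denomM x.2 y.2).
Definition frac_opp (x : frac) : frac := (- x.1, x.2).

End Fractions.

Definition frac_scale (R : comPzRingType) (S : mulrClosed R) (M : lmodType R)
  (x : frac S R^o) (y : frac S M) : frac S M :=
  ((x.1 : R) *: y.1, denomM x.2 y.2).

(* the localized module S^-1 M, first as an additive group *)
Definition locmod (R : comPzRingType) (S : mulrClosed R) (M : lmodType R) :
  Type := {eq_quot @frac_eq R S M}.

Section LocalizationZmod.
Variables (R : comPzRingType) (S : mulrClosed R) (M : lmodType R).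
Local Notation loc := (locmod S M).

HB.instance Definition _ : EqQuotient _ (@frac_eq R S M) loc :=
  EqQuotient.on loc.
HB.instance Definition _ := Choice.on loc.

Lemma loc_eqP (x y : frac S M) :
  reflect (exists2 t : R, t \in S &
             (t * sval y.2) *: x.1 = (t * sval x.2) *: y.1)
          (\pi_loc x == \pi_loc y).
Proof. by rewrite eqmodE; exact: asboolP. Qed.

Lemma loc_repr (x : frac S M) : exists2 t : R, t \in S &
  (t * sval x.2) *: (repr (\pi_loc x)).1 = (t * val (repr (\pi_loc x)).2) *: x.1.
Proof. by apply/loc_eqP; rewrite reprK. Qed.

Definition loc0 : loc := \pi_loc (0, denom1 S).
Definition loc_add := lift_op2 loc (@frac_add R S M).
Definition loc_opp := lift_op1 loc (@frac_opp R S M).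

Lemma pi_loc_add : {morph \pi_loc : x y / frac_add x y >-> loc_add x y}.
Proof.
move=> x y; unlock loc_add; apply/esym/eqP/loc_eqP => /=.
have [t St E] := loc_repr x; have [t' St' E'] := loc_repr y.
move: (repr _) E (repr _) E' => [u s] /= E [v r] /= E'.
exists (t * t'); first by rewrite rpredM.
rewrite !scalerDr !scalerA; congr (_ + _).
  transitivity ((t' * sval y.2 * sval r) *: ((t * sval x.2) *: u)).
    by rewrite scalerA; congr (_ *: _); ring.
  by rewrite E scalerA; congr (_ *: _); ring.
transitivity ((t * sval x.2 * sval s) *: ((t' * sval y.2) *: v)).
  by rewrite scalerA; congr (_ *: _); ring.
by rewrite E' scalerA; congr (_ *: _); ring.
Qed.

Lemma pi_loc_opp : {morph \pi_loc : x / frac_opp x >-> loc_opp x}.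
Proof.
move=> x; unlock loc_opp; apply/esym/eqP/loc_eqP => /=.
by have [t St E] := loc_repr x; exists t => //; rewrite !scalerN E.
Qed.

Lemma loc_addA : associative loc_add.
Proof.
elim/quotW=> x; elim/quotW=> y; elim/quotW=> z; rewrite -!pi_loc_add.
apply/eqP/loc_eqP; exists 1; rewrite ?rpred1 //= !mul1r.
by rewrite !scalerDr !scalerA addrA; congr (_ *: _ + _ *: _ + _ *: _); ring.
Qed.

Lemma loc_addC : commutative loc_add.
Proof.
elim/quotW=> x; elim/quotW=> y; rewrite -!pi_loc_add.
apply/eqP/loc_eqP; exists 1; rewrite ?rpred1 //= !mul1r.
by rewrite addrC [sval x.2 * _]mulrC.
Qed.

Lemma loc_add0 : left_id loc0 loc_add.
Proof.
elim/quotW=> x; rewrite /loc0 -pi_loc_add.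
apply/eqP/loc_eqP; exists 1; rewrite ?rpred1 //=.
by rewrite scaler0 add0r scale1r !mul1r.
Qed.

Lemma loc_addN : left_inverse loc0 loc_opp loc_add.
Proof.
elim/quotW=> x; rewrite /loc0 -pi_loc_opp -pi_loc_add.
apply/eqP/loc_eqP; exists 1; rewrite ?rpred1 //=.
by rewrite scalerN addNr !scaler0.
Qed.

HB.instance Definition _ :=
  GRing.isZmodule.Build loc loc_addA loc_addC loc_add0 loc_addN.

End LocalizationZmod.

Section LocalizationScale.
Variables (R : comPzRingType) (S : mulrClosed R) (M : lmodType R).

Fact loc_scale_key : unit. Proof. by []. Qed.
Definition loc_scale (x : locmod S R^o) (y : locmod S M) : locmod S M :=
  locked_with loc_scale_key (\pi_(locmod S M) (frac_scale (repr x) (repr y))).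

Lemma pi_loc_scale (x : frac S R^o) (y : frac S M) :
  loc_scale (\pi_(locmod S R^o) x) (\pi_(locmod S M) y) = \pi_(locmod S M) (frac_scale x y).
Proof.
rewrite /loc_scale unlock; apply/eqP/loc_eqP => /=.
have [t St E] := loc_repr x; have [t' St' E'] := loc_repr y.
move: (repr _) E (repr _) E' => [a s] /= E [v r] /= E'.
exists (t * t'); first by rewrite rpredM.
transitivity ((t * sval x.2 * a) *: ((t' * sval y.2) *: v)).
  by rewrite !scalerA; congr (_ *: _); ring.
have {}E : t * sval x.2 * a = t * sval s * x.1 := E.
by rewrite E E' !scalerA; congr (_ *: _); ring.
Qed.

End LocalizationScale.

(* the localized ring S^-1 R *)
Definition locring (R : comPzRingType) (S : mulrClosed R) : Type :=
  locmod S R^o.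

Section LocalizationRing.
Variables (R : comPzRingType) (S : mulrClosed R).
Local Notation loc := (locring S).

HB.instance Definition _ := GRing.Zmodule.on loc.

Definition loc1 : loc := \pi_(locmod S R^o) (1, denom1 S).
Definition loc_mul (x y : loc) : loc := @loc_scale R S R^o x y.

Lemma loc_mulA : associative loc_mul.
Proof.
elim/quotW=> x; elim/quotW=> y; elim/quotW=> z; rewrite /loc_mul !pi_loc_scale.
apply/eqP/loc_eqP; exists 1; rewrite ?rpred1 //= /GRing.scale/=; ring.
Qed.

Lemma loc_mulC : commutative loc_mul.
Proof.
elim/quotW=> x; elim/quotW=> y; rewrite /loc_mul !pi_loc_scale.
apply/eqP/loc_eqP; exists 1; rewrite ?rpred1 //= /GRing.scale/=; ring.
Qed.

Lemma loc_mul1 : left_id loc1 loc_mul.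
Proof.
elim/quotW=> x; rewrite /loc_mul /loc1 !pi_loc_scale.
apply/eqP/loc_eqP; exists 1; rewrite ?rpred1 //= /GRing.scale/=; ring.
Qed.

Lemma loc_mulDl : left_distributive loc_mul +%R.
Proof.
elim/quotW=> x; elim/quotW=> y; elim/quotW=> z.
rewrite /loc_mul /GRing.add/= -pi_loc_add !pi_loc_scale -pi_loc_add.
apply/eqP/loc_eqP; exists 1; rewrite ?rpred1 //= /GRing.scale/=; ring.
Qed.

HB.instance Definition _ := GRing.Zmodule_isComPzRing.Build loc
  loc_mulA loc_mulC loc_mul1 loc_mulDl.

End LocalizationRing.

Section LocalizationModule.
Variables (R : comPzRingType) (S : mulrClosed R) (M : lmodType R).

Definition loc_act (x : locring S) (y : locmod S M) : locmod S M :=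
  loc_scale x y.

Lemma loc_actA x y z : loc_act x (loc_act y z) = loc_act (x * y) z.
Proof.
elim/quotW: x => x; elim/quotW: y => y; elim/quotW: z => z.
rewrite {1}/GRing.mul/= /loc_act /loc_mul !pi_loc_scale.
apply/eqP/loc_eqP; exists 1; rewrite ?rpred1 //= !scalerA.
by congr (_ *: _); rewrite /GRing.scale/=; ring.
Qed.

Lemma loc_act1 : left_id 1 loc_act.
Proof.
elim/quotW=> x; rewrite /loc_act {1}/GRing.one/= /loc1 pi_loc_scale.
by apply/eqP/loc_eqP; exists 1; rewrite ?rpred1 //= scale1r !mul1r.
Qed.

Lemma loc_actDr : right_distributive loc_act +%R.
Proof.
elim/quotW=> x; elim/quotW=> y; elim/quotW=> z.
rewrite /loc_act {1 2}/GRing.add/= -pi_loc_add !pi_loc_scale -pi_loc_add.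
apply/eqP/loc_eqP; exists 1; rewrite ?rpred1 //= !scalerDr !scalerA.
by congr (_ *: _ + _ *: _); ring.
Qed.

Lemma loc_actDl y : {morph loc_act^~ y : a b / a + b}.
Proof.
elim/quotW: y => y; elim/quotW=> a; elim/quotW=> b.
rewrite /loc_act {1 2}/GRing.add/= -pi_loc_add !pi_loc_scale -pi_loc_add.
apply/eqP/loc_eqP; exists 1; rewrite ?rpred1 //= !scalerDl !scalerDr !scalerA.
by congr (_ *: _ + _ *: _); rewrite /GRing.scale/=; ring.
Qed.

HB.instance Definition _ := GRing.Zmodule_isLmodule.Build (locring S)
  (locmod S M) loc_actA loc_act1 loc_actDr loc_actDl.

End LocalizationModule.

Section LocalizationAtPrime.
Variables (R : comPzRingType) (p : set R).

Definition prime_compl (_ : is_prime p) : {pred R} := fun s => s \notin p.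

Variable hp : is_prime p.

Lemma prime_compl_mulr : mulr_closed (prime_compl hp).
Proof.
have [_ p1 pM] := hp; split; first by rewrite unfold_in notin_setE.
move=> a b; rewrite /prime_compl !unfold_in !notin_setE => pa pb /pM.
by case.
Qed.

HB.instance Definition _ :=
  GRing.isMulClosed.Build R (prime_compl hp) prime_compl_mulr.

(* R_p and M_p *)
Definition ring_at : comPzRingType := locring (prime_compl hp).
Definition module_at (M : lmodType R) : lmodType ring_at :=
  locmod (prime_compl hp) M.

End LocalizationAtPrime.

Section HomologicalAlgebra.
Variable R : comPzRingType.

Definition is_exact (U V W : lmodType R) (f : {linear U -> V})
    (g : {linear V -> W}) : Prop :=
  forall v : V, g v = 0 <-> exists u : U, v = f u.

Definition injective_module (E : lmodType R) : Prop :=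
  forall (U V : lmodType R) (i : {linear U -> V}) (f : {linear U -> E}),
    injective i -> exists g : {linear V -> E}, forall u, g (i u) = f u.

Definition projective_module (P : lmodType R) : Prop :=
  forall (U V : lmodType R) (q : {linear U -> V}) (f : {linear P -> V}),
    (forall v, exists u, q u = v) ->
    exists g : {linear P -> U}, forall x, q (g x) = f x.

(* 0 -> M -> I_0 -> I_1 -> ... *)
Record injective_resolution (M : lmodType R) := InjectiveResolution {
  inj_obj : nat -> lmodType R;
  inj_diff : forall n, {linear inj_obj n -> inj_obj n.+1};
  inj_aug : {linear M -> inj_obj 0%N};
  inj_objP : forall n, injective_module (inj_obj n);
  inj_augP : injective inj_aug;
  inj_exact0 : is_exact inj_aug (inj_diff 0%N);
  inj_exact : forall n, is_exact (inj_diff n) (inj_diff n.+1) }.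

Definition fin_inj_dim (M : lmodType R) : Prop :=
  exists (E : injective_resolution M) (n : nat),
    forall i, (n < i)%N -> trivial_module (inj_obj E i).

(* ... -> P_1 -> P_0 -> N -> 0 *)
Record projective_resolution (N : lmodType R) := ProjectiveResolution {
  proj_obj : nat -> lmodType R;
  proj_diff : forall n, {linear proj_obj n.+1 -> proj_obj n};
  proj_aug : {linear proj_obj 0%N -> N};
  proj_objP : forall n, projective_module (proj_obj n);
  proj_augP : forall x : N, exists u, proj_aug u = x;
  proj_exact0 : is_exact (proj_diff 0%N) proj_aug;
  proj_exact : forall n, is_exact (proj_diff n.+1) (proj_diff n) }.

Section Ext.
Variables (N M : lmodType R) (P : projective_resolution N).

(* degree-n cocycles and coboundaries of the complex Hom_R(P, M) *)
Definition cocycle (n : nat) (f : proj_obj P n -> M) : Prop :=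
  linear f /\ forall x, f (proj_diff P n x) = 0.

Definition coboundary (n : nat) : (proj_obj P n -> M) -> Prop :=
  match n with
  | 0%N => fun f => forall x, f x = 0
  | k.+1 => fun f =>
      exists g : {linear proj_obj P k -> M}, forall x, f x = g (proj_diff P k x)
  end.

End Ext.

(* The R/m-dimension of Ext^n_R(R/m, M) is r: there are r cocycles whose
   classes form an R/m-basis of the cohomology of Hom_R(P, M) in degree n,
   where P is a projective resolution of R/m. *)
Definition ext_residue_dim (m : set R) (hm : is_maximal m) (M : lmodType R)
    (n r : nat) : Prop :=
  exists (P : projective_resolution (residue_field hm))
         (e : 'I_r -> proj_obj P n -> M),
    [/\ forall i, cocycle (e i),
        forall f : proj_obj P n -> M, cocycle f -> exists a : 'I_r -> R,
          coboundary (fun x => f x - \sum_(i < r) a i *: e i x) &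
        forall a : 'I_r -> R,
          coboundary (fun x => \sum_(i < r) a i *: e i x) -> forall i, m (a i)].

End HomologicalAlgebra.

Section CohenMacaulayLocal.
Variable R : comPzRingType.

(* (x_1, ..., x_n) M *)
Definition seq_smul (M : lmodType R) (xs : seq R) : set M :=
  smul (@span R R^o [set` xs]) setT.
Arguments seq_smul : clear implicits.

Definition regular_seq (M : lmodType R) (xs : seq R) : Prop :=
  seq_smul M xs <> [set: M] /\
  forall (i : nat) (u : M), (i < size xs)%N ->
    seq_smul M (take i xs) (xs`_i *: u) -> seq_smul M (take i xs) u.

(* For finitely generated M over a Noetherian local ring (R, m), all maximal
   M-regular sequences in m have the same length, so any one of them gives the
   depth. *)
Definition has_depth (m : set R) (M : lmodType R) (n : nat) : Prop :=
  exists xs : seq R,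
    [/\ size xs = n, regular_seq M xs, forall x, x \in xs -> m x &
        forall y, m y -> ~ regular_seq M (rcons xs y)].

(* a chain p_0 < ... < p_n of primes containing Ann M *)
Definition prime_chain (M : lmodType R) (n : nat) (p : nat -> set R) : Prop :=
  (forall i, (i <= n)%N -> is_prime (p i) /\ annihilator M `<=` p i) /\
  (forall i, (i < n)%N -> p i `<` p i.+1).

Definition has_krull_dim (M : lmodType R) (n : nat) : Prop :=
  (exists p, prime_chain M n p) /\
  (forall k p, prime_chain M k p -> (k <= n)%N).

Definition cm_module (m : set R) (M : lmodType R) : Prop :=
  [/\ fin_gen M, ~ trivial_module M &
      exists n, has_depth m M n /\ has_krull_dim M n].

Definition maximal_cm_module (m : set R) (M : lmodType R) : Prop :=
  cm_module m M /\ exists n, has_krull_dim M n /\ has_krull_dim R^o n.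

Definition has_type (m : set R) (hm : is_maximal m) (M : lmodType R)
    (r : nat) : Prop :=
  exists2 n, has_depth m M n & ext_residue_dim hm M n r.

Definition cm_local_ring : Prop :=
  exists m : set R, local_ring m /\ cm_module m R^o.

(* Bruns-Herzog: a maximal Cohen-Macaulay module of type 1 and of finite
   injective dimension, over a Cohen-Macaulay local ring. *)
Definition canonical_module_local (C : lmodType R) : Prop :=
  exists (m : set R) (hm : is_maximal m),
    [/\ local_ring m, maximal_cm_module m C, has_type hm C 1 & fin_inj_dim C].

End CohenMacaulayLocal.

Section Global.
Variable A : comPzRingType.

Definition cohen_macaulay : Prop :=
  forall (m : set A) (hm : is_maximal m),
    cm_local_ring (ring_at (maximal_prime hm)).

Definition canonical_module (w : lmodType A) : Prop :=
  fin_gen w /\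
  forall (m : set A) (hm : is_maximal m),
    canonical_module_local (module_at (maximal_prime hm) w).

Definition r_ideal (I : set A) (M : lmodType A) : set A :=
  \bigcup_k colon (smul (ideal_exp I k.+1) [set: M])
                  (smul (ideal_exp I k) [set: M]).

End Global.

(* Main.v *)
Require Import Defs.
From HB Require Import structures.
From mathcomp Require Import all_boot all_order all_algebra.
From mathcomp Require Import generic_quotient.
From mathcomp Require Import boolp classical_sets ring.
Import Defs.

(* Proof. If a I^k w1 is contained in I^(k+1) w1, then a I^k w2 is contained
   in I^(k+1) w2 as soon as, at every maximal ideal, w2 is a homomorphic image
   of w1.  So it is enough to show that over a Cohen-Macaulay local ring (R, m)
   every canonical module C2 is an image of every canonical module C1.

   Let d = dim R.  By prime avoidance some sequence x of length d in m is
   regular on R, C1 and C2 at once, because Ext^i(R/m, -) vanishes on these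
   three modules for i < d.  Reducing modulo x turns C1 and C2 into injective
   modules W1 and W2 over the Artinian ring R/x: the x-torsion of a finite
   injective resolution is again such a resolution, and over an Artinian ring
   the kernel of a surjection between injective modules is injective.  Type one
   gives W1 and W2 simple socles, and therefore W1 and W2 are isomorphic.
   Finally W1 -> W2 lifts to C1 -> C2, since Ext^1(C1, C2) = 0 by Nakayama's
   lemma, and the lift is surjective by Nakayama's lemma again. *)

Set Implicit Arguments.
Unset Strict Implicit.
Unset Printing Implicit Defensive.

Import GRing.Theory.
Local Open Scope classical_set_scope.
Local Open Scope ring_scope.
Local Open Scope quotient_scope.

(** * Submodules, quotients and Noetherian modules *)

(** Only surjections are built: the two canonical modules play symmetric roles, so each inclusion of
    ideals is one application.

    R/(x) never appears as a ring. It is the cyclic R-module [quot_seq R^o xs], and its modules are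
    the R-modules killed by its annihilator J. That it is Artinian enters as one property: a nonzero
    element of a module killed by J has a nonzero multiple in the socle. This comes from dimension,
    since a prime over J other than m would lengthen, through x, to a chain longer than d.

    The terms of an injective resolution are rarely finitely generated, so Nakayama's lemma cannot
    show that the kernel Z of E -> Q is injective. Instead, R/m embeds in R/J, which lets socle
    elements of Q lift to socle elements of E; this amounts to Ext^1(R/m, Z) = 0, and Zorn's lemma
    extends maps one socle element at a time.

    Depth and type are witnessed by some regular sequence and some projective resolution of R/m.
    Different choices are never compared: a regular sequence in m forces vanishing below its length
    for every resolution, and each type is used with its own resolution. *)

Section SubmoduleClosure.
Variables (R : comPzRingType) (M : lmodType R).
Implicit Types (N : set M) (u v : M) (a : R).

Lemma is_submoduleP N :
  is_submodule N <-> N 0 /\ forall a u v, N u -> N v -> N (a *: u + v).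
Proof.
split=> [[N0 NL]|[N0 NL]].
  split=> [|a u v Nu Nv]; first by rewrite inE in N0.
  by have := NL a u v; rewrite !inE; apply.
by split=> [|a u v]; rewrite !inE //; exact: NL.
Qed.

Lemma smod0 N : is_submodule N -> N 0.
Proof. by case/is_submoduleP. Qed.

Lemma smodL N a u v : is_submodule N -> N u -> N v -> N (a *: u + v).
Proof. by case/is_submoduleP => _; apply. Qed.

Lemma smodZ N a u : is_submodule N -> N u -> N (a *: u).
Proof. by move=> hN Nu; rewrite -[_ *: _]addr0; apply: smodL => //; exact: smod0. Qed.

Lemma smodD N u v : is_submodule N -> N u -> N v -> N (u + v).
Proof. by move=> hN Nu Nv; rewrite -[u]scale1r; apply: smodL. Qed.

Lemma smodN N u : is_submodule N -> N u -> N (- u).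
Proof. by move=> hN Nu; rewrite -scaleN1r; apply: smodZ. Qed.

Lemma smodB N u v : is_submodule N -> N u -> N v -> N (u - v).
Proof. by move=> hN Nu Nv; apply: smodD => //; apply: smodN. Qed.

Lemma smod_sum N (I : finType) (P : pred I) (F : I -> M) :
  is_submodule N -> (forall i, P i -> N (F i)) -> N (\sum_(i | P i) F i).
Proof.
move=> hN NF; elim/big_rec: _ => [|i u Pi Nu]; first exact: smod0.
by apply: smodD => //; apply: NF.
Qed.

Lemma smodI N N' : is_submodule N -> is_submodule N' -> is_submodule (N `&` N').
Proof.
move=> hN hN'; apply/is_submoduleP; split; first by split; exact: smod0.
by move=> a u v [Nu N'u] [Nv N'v]; split; exact: smodL.
Qed.

Lemma smodT : is_submodule [set: M].
Proof. by apply/is_submoduleP. Qed.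

Lemma smod_set0 : is_submodule [set 0 : M].
Proof. by apply/is_submoduleP; split=> // a u v -> ->; rewrite scaler0 addr0. Qed.

End SubmoduleClosure.

Section Ideal.
Variables (R : comPzRingType) (I : set R) (hI : is_ideal I).

Lemma idl0 : I 0. Proof. exact: (@smod0 _ R^o). Qed.
Lemma idlM a b : I b -> I (a * b). Proof. exact: (@smodZ _ R^o). Qed.
Lemma idlMr a b : I a -> I (a * b). Proof. by rewrite mulrC; exact: idlM. Qed.
Lemma idlD a b : I a -> I b -> I (a + b). Proof. exact: (@smodD _ R^o). Qed.

End Ideal.

Section SpanTheory.
Variables (R : comPzRingType) (M : lmodType R).
Implicit Types (N : set M) (s : seq M).

Lemma smulP (I : set R) (N : set M) : is_ideal I ->
  is_submodule (smul I N).
Proof.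
move=> hI; apply/is_submoduleP; split.
  by exists 0%N, (fun=> 0), (fun=> 0); split; rewrite ?big_ord0 // => -[].
move=> c _ _ [n [a [u [Ia Nu ->]]]] [p [b [v [Ib Nv ->]]]].
exists (n + p)%N,
  (fun i => match split i with inl j => c * a j | inr j => b j end),
  (fun i => match split i with inl j => u j | inr j => v j end); split.
- by move=> i; case: (split i) => j //; exact: idlM.
- by move=> i; case: (split i) => j.
rewrite scaler_sumr big_split_ord; congr (_ + _); apply: eq_bigr => i _.
  case: splitP => [j /= /val_inj <-|k /= E]; rewrite ?scalerA //.
  by move: (ltn_ord i); rewrite E ltnNge leq_addr.
case: splitP => [j /= E|k /= /addnI /val_inj <- //].
by move: (ltn_ord j); rewrite -E ltnNge leq_addr.
Qed.

Lemma smul_gen (I : set R) N a u : I a -> N u -> smul I N (a *: u).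
Proof.
move=> Ia Nu; exists 1%N, (fun=> a), (fun=> u); split => //.
by rewrite big_ord1.
Qed.

Lemma smul_least (I : set R) N N' : is_submodule N' ->
  (forall a u, I a -> N u -> N' (a *: u)) -> smul I N `<=` N'.
Proof. by move=> hN' H _ [n [a [u [Ia Nu ->]]]]; apply: smod_sum => // i _; exact: H. Qed.

Lemma spanS (X : set M) : X `<=` span X.
Proof. by move=> u Xu; rewrite -[u]scale1r; apply: smul_gen. Qed.

Lemma spanP (X : set M) : is_submodule (span X).
Proof. by apply: smulP; apply/is_submoduleP. Qed.

Lemma span_least (X : set M) N : is_submodule N -> X `<=` N -> span X `<=` N.
Proof. by move=> hN XN; apply: smul_least => // a u _ /XN Nu; exact: smodZ. Qed.

Lemma span_nilE u : span [set` ([::] : seq M)] u -> u = 0.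
Proof. exact: (@span_least _ [set 0] (smod_set0 M)). Qed.

Lemma span_consP g s u :
  span [set` (g :: s)] u <-> exists a v, span [set` s] v /\ u = a *: g + v.
Proof.
split; last first.
  move=> [a [v [sv ->]]]; apply: smodL; first exact: spanP.
    by apply: spanS; rewrite /= inE eqxx.
  apply: span_least sv; first exact: spanP.
  by move=> w /= ws; apply: spanS; rewrite /= inE ws orbT.
apply: (@span_least _ [set u | exists a v, span [set` s] v /\ u = a *: g + v]).
  apply/is_submoduleP; split.
    by exists 0, 0; rewrite scale0r addr0; split=> //; apply: smod0; exact: spanP.
  move=> c _ _ [a [v [sv ->]]] [b [w [sw ->]]].
  exists (c * a + b), (c *: v + w); split; first by apply: smodL => //; exact: spanP.
  by rewrite scalerDr scalerDl !scalerA addrACA.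
move=> v /=; rewrite inE => /orP[/eqP->|vs].
  by exists 1, 0; rewrite scale1r addr0; split=> //; apply: smod0; exact: spanP.
by exists 0, v; rewrite scale0r add0r; split=> //; apply: spanS.
Qed.

Lemma span_sub s s' : {subset s <= s'} -> span [set` s] `<=` span [set` s'].
Proof.
move=> ss'; apply: span_least; first exact: spanP.
by move=> u /ss' us'; apply: spanS.
Qed.

End SpanTheory.

Section Linear.
Variables (R : comPzRingType) (U V : lmodType R) (f : U -> V).
Definition lin_of (_ : linear f) : U -> V := f.
Variable hf : linear f.
HB.instance Definition _ := GRing.isLinear.Build R U V *:%R (lin_of hf) hf.
Lemma mklin_subproof : {g : {linear U -> V} | forall u, g u = f u}.
Proof. by exists (lin_of hf). Qed.
(* opaque, so that rewriting does not unfold applications of [mklin] *)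
Definition mklin : {linear U -> V} := sval mklin_subproof.
Lemma mklinE u : mklin u = f u. Proof. exact: (svalP mklin_subproof). Qed.
End Linear.

Section SubmoduleType.
Variables (R : comPzRingType) (M : lmodType R) (N : set M).
Variable hN : is_submodule N.

Definition submodule_type : Type := {u : M | u \in submodule_pred hN}.
HB.instance Definition _ := SubChoice.on submodule_type.
HB.instance Definition _ := [SubChoice_isSubLmodule of submodule_type by <:].
Definition submodule : lmodType R := submodule_type.

Definition subval : submodule -> M := val.
Lemma subval_linear : linear subval.
Proof. by move=> a u v; rewrite /subval linearP. Qed.
Definition subincl : {linear submodule -> M} := mklin subval_linear.

Lemma subincl_inj : injective subincl.
Proof. by move=> u v; rewrite !mklinE => /val_inj. Qed.

Lemma subinclP u : N (subincl u).
Proof. by rewrite mklinE; have := valP u; rewrite inE. Qed.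

Lemma subincl_surj u : N u -> exists v, subincl v = u.
Proof.
move=> Nu; have Nu' : u \in submodule_pred hN by rewrite inE.
by exists (exist _ u Nu'); rewrite mklinE.
Qed.

End SubmoduleType.

Lemma subcorestr (R : comPzRingType) (U M : lmodType R) (N : set M)
    (hN : is_submodule N) (f : {linear U -> M}) :
  (forall u, N (f u)) -> exists g : {linear U -> submodule hN}, forall u, subincl hN (g u) = f u.
Proof.
move=> Nf; have /choice[g gE] u := subincl_surj hN (Nf u).
have glin : linear g.
  by move=> a u v; apply: (@subincl_inj _ _ _ hN); rewrite linearP !gE linearP.
by exists (mklin glin) => u; rewrite mklinE gE.
Qed.

Section QuotientTheory.
Variables (R : comPzRingType) (M : lmodType R) (N : set M).
Variable hN : is_submodule N.
Local Notation Q := (quotient_module hN).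

Definition qpi_fun (u : M) : Q := \pi_Q u.
Lemma qpi_linear : linear qpi_fun.
Proof.
by move=> a u v; rewrite /qpi_fun pi_quotD -quot_scale_pi.
Qed.
Definition qpi : {linear M -> Q} := mklin qpi_linear.

Lemma qpi_surj (x : Q) : exists u, qpi u = x.
Proof. by exists (repr x); rewrite mklinE; exact: reprK. Qed.

Lemma qpi_eq0 u : qpi u = 0 <-> N u.
Proof.
rewrite -[0](linear0 qpi) !mklinE /qpi_fun; split.
  by move=> /eqP; rewrite -Quotient.idealrBE subr0 inE.
by move=> Nu; apply/eqP; rewrite -Quotient.idealrBE subr0 inE.
Qed.

End QuotientTheory.

Section SurjLift.
Variables (R : comPzRingType) (M P Q : lmodType R).

Lemma lift_surj (q : {linear M -> Q}) (f : {linear M -> P}) :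
  (forall x, exists u, q u = x) -> (forall u, q u = 0 -> f u = 0) ->
  exists g : {linear Q -> P}, forall u, g (q u) = f u.
Proof.
move=> /choice[s sE] qf.
have E u v : q u = q v -> f u = f v.
  move=> quv; apply/eqP; rewrite -subr_eq0 -linearB; apply/eqP/qf.
  by rewrite linearB quv subrr.
have hg : linear (f \o s).
  by move=> a x y /=; rewrite -linearP; apply: E; rewrite linearP !sE.
by exists (mklin hg) => u; rewrite mklinE; apply: E; rewrite sE.
Qed.

End SurjLift.

Section Quot1.
Variables (R : comPzRingType) (M : lmodType R) (x : R).

Definition mulset : set M := [set u | exists v, u = x *: v].

Lemma mulsetP : is_submodule mulset.
Proof.
apply/is_submoduleP; split; first by exists 0; rewrite scaler0.
move=> a _ _ [u ->] [v ->]; exists (a *: u + v).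
by rewrite scalerDr !scalerA mulrC.
Qed.

Definition quot1 : lmodType R := quotient_module mulsetP.
Definition pi1 : {linear M -> quot1} := qpi mulsetP.

Lemma pi1_surj y : exists u, pi1 u = y. Proof. exact: qpi_surj. Qed.
Lemma pi1_eq0 u : pi1 u = 0 <-> exists v, u = x *: v.
Proof. exact: qpi_eq0. Qed.
Lemma pi1x u : pi1 (x *: u) = 0. Proof. by apply/pi1_eq0; exists u. Qed.
Lemma quot1x (y : quot1) : x *: y = 0.
Proof. by have [u <-] := pi1_surj y; rewrite -linearZ pi1x. Qed.
Lemma pi1_eq u v : pi1 u = pi1 v -> exists w, u = v + x *: w.
Proof.
move=> E; have /pi1_eq0[w wE] : pi1 (u - v) = 0 by rewrite linearB E subrr.
by exists w; rewrite -wE addrC subrK.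
Qed.

Lemma fin_gen_surj (P : lmodType R) (f : {linear M -> P}) :
  (forall y, exists u, f u = y) -> fin_gen M -> fin_gen P.
Proof.
move=> fs [s sT]; exists (map f s); apply/seteqP; split=> // y _.
have [u <-] := fs y; have : span [set` s] u by rewrite sT.
apply: (@span_least _ _ _ [set u | span [set` map f s] (f u)]).
  apply/is_submoduleP; split; first by rewrite /= linear0; apply: smod0; exact: spanP.
  by move=> a v w /= sv sw; rewrite linearP; apply: smodL => //; exact: spanP.
by move=> v vs; apply: spanS; apply: map_f.
Qed.

End Quot1.

Lemma fin_gen_quot1 (R : comPzRingType) (M : lmodType R) (x : R) :
  fin_gen M -> fin_gen (quot1 M x).
Proof. by apply: fin_gen_surj (@pi1_surj R M x). Qed.

(* M / (x_1, ..., x_n) M as an iterated quotient, so that regular sequences can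
   be handled by induction from their first term *)
Fixpoint quot_seq (R : comPzRingType) (M : lmodType R) (xs : seq R) : lmodType R :=
  if xs is x :: xs' then quot_seq (quot1 M x) xs' else M.

Definition nzd (R : comPzRingType) (M : lmodType R) (x : R) : Prop :=
  forall u : M, x *: u = 0 -> u = 0.

(* [weak_regular M xs] drops the condition M <> (xs) M from [regular_seq] *)
Fixpoint weak_regular (R : comPzRingType) (M : lmodType R) (xs : seq R) : Prop :=
  if xs is x :: xs' then nzd M x /\ weak_regular (quot1 M x) xs' else True.

Fixpoint pi_seq (R : comPzRingType) (M : lmodType R) (xs : seq R) :
    {linear M -> quot_seq M xs} :=
  match xs with
  | [::] => [the {linear M -> M} of idfun]
  | x :: xs' => [the {linear M -> _} of pi_seq (quot1 M x) xs' \o pi1 M x]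
  end.

Lemma pi_seq_surj (R : comPzRingType) (M : lmodType R) (xs : seq R) y :
  exists u, pi_seq M xs u = y.
Proof.
elim: xs M y => [|x xs IH] M y /=; first by exists y.
by have [v <-] := IH _ y; have [u <-] := pi1_surj v; exists u.
Qed.

Lemma pi_seq_eq0 (R : comPzRingType) (m : set R) (M : lmodType R) (xs : seq R) u :
  is_ideal m -> (forall x, x \in xs -> m x) ->
  pi_seq M xs u = 0 -> smul m [set: M] u.
Proof.
move=> hm; elim: xs M u => [|x xs IH] M u xm /=.
  by move=> ->; apply: smod0; exact: smulP.
move=> /IH /=; case; first by move=> y ys; apply: xm; rewrite inE ys orbT.
move=> n [a [v [ma _ E]]].
have /choice[w wE] i := pi1_surj (v i).
have /pi1_eq[z ->] : pi1 M x u = pi1 M x (\sum_(i < n) a i *: w i).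
  by rewrite E linear_sum; apply: eq_bigr => i _; rewrite linearZ wE.
have hs : is_submodule (smul m [set: M]) by exact: smulP.
apply: smodD => //; last by apply: smul_gen => //; apply: xm; rewrite inE eqxx.
by apply: smod_sum => // i _; exact: smul_gen.
Qed.

Section Noetherian.
Variables (R : comPzRingType) (Rn : noetherian R).

Definition noeth_mod (M : lmodType R) :=
  forall N : set M, is_submodule N -> exists s : seq M, N = span [set` s].

(** Induction on the generators: the coefficients at [g] of elements of N form an ideal [I], and
    lifts of generators of [I], together with generators of the part of N inside the span of [s],
    generate N. *)
Lemma noeth_fin_gen (M : lmodType R) : fin_gen M -> noeth_mod M.
Proof.
move=> [s sT] N hN.
have : N `<=` span [set` s] by rewrite sT.
elim: s {sT} N hN => [|g s IH] N hN Ns.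
  exists [::]; apply/seteqP; split=> // u /span_nilE ->; exact: smod0.
pose I : set R := [set a | exists v, span [set` s] v /\ N (a *: g + v)].
have hI : is_ideal I.
  apply/is_submoduleP; split.
    by exists 0; rewrite scale0r addr0; split; apply: smod0 => //; exact: spanP.
  move=> c a b [v [sv Nv]] [w [sw Nw]]; exists (c *: v + w); split.
    by apply: smodL => //; exact: spanP.
  have := smodL c hN Nv Nw; congr N.
  by rewrite scalerDr addrACA scalerA scalerDl.
have [t tE] := Rn hI.
have /IH [] : is_submodule (N `&` span [set` s]) by apply: smodI => //; exact: spanP.
  by move=> u [].
move=> s' s'E.
have /choice[n nP] : forall a : R, exists v : M, a \in t -> span [set` s] v /\ N (a *: g + v).
  move=> a; case: (boolP (a \in t)) => [at_|_]; last by exists 0.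
  suff [v hv] : I a by exists v.
  by rewrite tE; apply: (@spanS _ R^o).
exists ([seq a *: g + n a | a <- t] ++ s'); apply/seteqP; split; last first.
  apply: span_least => // u /=; rewrite mem_cat => /orP[/mapP[a at_ ->]|us'].
    by have [] := nP a at_.
  by have [] : (N `&` span [set` s]) u by rewrite s'E; exact: spanS.
move=> u Nu; have /span_consP[a [v [sv uE]]] := Ns _ Nu.
have Ia : I a by exists v; rewrite -uE.
set S := span _.
have hS : is_submodule S by exact: spanP.
(* The coefficient a is a combination of generators of [I]; the same combination of their lifts has
   the form a g + w, and subtracting it from u removes the [g] term. *)
have [w [Sw sw]] : exists w, S (a *: g + w) /\ (N `&` span [set` s]) (v - w).
  have: exists w, [/\ S (a *: g + w), N (a *: g + w) & span [set` s] w].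
    rewrite tE in Ia.
    move: Ia; apply: (@span_least _ R^o _ [set a | exists w,
      [/\ S (a *: g + w), N (a *: g + w) & span [set` s] w]]).
      apply/is_submoduleP; split.
        by exists 0; rewrite scale0r addr0; split; apply: smod0 => //; exact: spanP.
      move=> c b b' [w [Sw Nw sw]] [w' [Sw' Nw' sw']]; exists (c *: w + w').
      have -> : (c *: (b : R^o) + b') *: g + (c *: w + w') =
        c *: (b *: g + w) + (b' *: g + w').
        by rewrite scalerDr addrACA scalerA scalerDl.
      by split; apply: smodL => //; exact: spanP.
    move=> b /= bt; exists (n b); have [? ?] := nP b bt; split=> //.
    by apply: spanS; rewrite /= mem_cat; apply/orP; left; apply/mapP; exists b.
  move=> [w [Sw Nw sw]]; exists w; split=> //; split; last first.
    by apply: smodB => //; exact: spanP.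
  have := smodB hN Nu Nw; congr N; rewrite uE [v - w]addrC.
  by rewrite opprD addrACA subrr add0r addrC.
have -> : u = (a *: g + w) + (v - w) by rewrite uE -addrA [w + _]addrC subrK.
apply: smodD => //; rewrite s'E in sw; apply: span_sub sw => z zs.
by rewrite mem_cat zs orbT.
Qed.

(** The empty set is adjoined to P because Zorn's lemma also asks for the union of the empty chain.
    For other chains, the finitely many generators of the union already lie in one member. *)
Lemma noeth_max (P : set (set R)) : (exists I, P I) -> (forall I, P I -> is_ideal I) ->
  exists I, P I /\ forall J, P J -> I `<=` J -> J = I.
Proof.
move=> [I0 PI0] Pid.
have [I [PI Imax]] : exists I, (I = set0 \/ P I) /\ forall J, I `<` J -> ~ (J = set0 \/ P J).
  apply: (@Zorn_bigcup R [set I | I = set0 \/ P I]) => F FP Ftot.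
  have [[A [FA nA]]|noA] := pselect (exists A, F A /\ P A); last first.
    left; apply/seteqP; split=> // a [B FB Ba].
    by case: (FP _ FB) => [B0|PB]; [rewrite B0 in Ba|case: noA; exists B].
  right; set U := \bigcup_(X in F) X.
  have FU B : F B -> B `<=` U by move=> FB b Bb; exists B.
  have hA := Pid _ nA.
  have key a b : U a -> U b -> exists B, [/\ F B, is_ideal B, B a & B b].
    move=> [B FB Ba] [C FC Cb].
    have hB : is_ideal B by case: (FP _ FB) => [E|/Pid//]; rewrite E in Ba.
    have hC : is_ideal C by case: (FP _ FC) => [E|/Pid//]; rewrite E in Cb.
    have [BC|CB] := Ftot _ _ FB FC; first by exists C; split=> //; exact: BC.
    by exists B; split=> //; exact: CB.
  have hU : is_ideal U.
    apply/is_submoduleP; split; first by exists A => //; exact: smod0.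
    move=> c a b Ua Ub; have [B [FB hB Ba Bb]] := key a b Ua Ub.
    by exists B => //; apply: (@smodL _ R^o).
  have [s sE] := Rn hU.
  have : forall a, a \in s -> U a by move=> a as_; rewrite sE; apply: (@spanS _ R^o).
  move=> sU; have [B [FB PB sB]] : exists B, [/\ F B, P B & forall a, a \in s -> B a].
    elim: (s) sU => [|a s' IH] sU; first by exists A.
    have [|B [FB PB s'B]] := IH; first by move=> b bs; apply: sU; rewrite inE bs orbT.
    have [C FC Ca] := sU a (mem_head _ _).
    have [BC|CB] := Ftot _ _ FB FC.
      exists C; split=> //; first by case: (FP _ FC) => // E; rewrite E in Ca.
      by move=> b; rewrite inE => /orP[/eqP->//|/s'B/BC].
    exists B; split=> // b; rewrite inE => /orP[/eqP->//|/s'B//]; exact: CB.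
  suff -> : U = B by [].
  apply/seteqP; split; last exact: FU.
  by rewrite {1}sE; apply: (@span_least R R^o) => //; exact: Pid.
have nonemp : P I.
  case: PI => // I00; case: (Imax I0); last by right.
  rewrite I00 properEneq; split=> //; apply/eqP => E.
  by have /idl0 := Pid _ PI0; rewrite -E.
exists I; split=> // J PJ IJ; apply: contrapT => nJI.
case: (Imax J); last by right.
by rewrite properEneq; split=> //; apply/eqP => E; apply: nJI.
Qed.

End Noetherian.

Lemma exists_maximal (R : comPzRingType) (J : set R) : noetherian R -> is_ideal J ->
  ~ J 1 -> exists2 m, is_maximal m & J `<=` m.
Proof.
move=> Rn hJ J1.
have [|I []//|I [[hI I1 JI] Imax]] := @noeth_max _ Rn
  [set I | [/\ is_ideal I, ~ I 1 & J `<=` I]]; first by exists J; split.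
exists I => //; split=> // K hK K1 IK; apply: Imax => //; split=> //.
exact: subset_trans IK.
Qed.

(** * Nakayama's lemma *)

Section Local.
Variables (R : comPzRingType) (m : set R).

Definition local_max : Prop :=
  is_maximal m /\ forall a, ~ m a -> exists b, b * a = 1.

(** In the relation for [h] the coefficient of [h] on the right lies in m, so 1 - a is invertible
    and the relation can be solved for [h]; substitution removes [h] from the other relations.
    Neither G nor the span has to contain the other, which suits the use with submodules of a power
    of M. *)
Lemma nakayama (M : lmodType R) (G : set M) (s : seq M) : local_max ->
  is_submodule G ->
  (forall u, u \in s -> exists g v, [/\ G g, smul m (span [set` s]) v & u = g + v]) ->
  forall u, span [set` s] u -> G u.
Proof.
move=> [[hm m1 _] mu] hG.
elim: s => [|h s IH] H u.
  by move=> /span_nilE ->; exact: smod0.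
have msP w : smul m (span [set` (h :: s)]) w ->
    exists a v, [/\ m a, smul m (span [set` s]) v & w = a *: h + v].
  have hms : is_submodule (smul m (span [set` s])) by exact: smulP.
  apply: (@smul_least _ _ _ _ [set w | exists a v,
     [/\ m a, smul m (span [set` s]) v & w = a *: h + v]]).
    apply/is_submoduleP; split.
      by exists 0, 0; rewrite scale0r addr0; split=> //;
        [exact: idl0|exact: smod0].
    move=> c _ _ [a [v [ma sv ->]]] [b [z [mb sz ->]]].
    exists (c * a + b), (c *: v + z); split.
    - by apply: idlD => //; exact: idlM.
    - exact: smodL.
    by rewrite scalerDr scalerDl !scalerA addrACA.
  move=> a w' ma /span_consP[b [v [sv ->]]]; exists (a * b), (a *: v); split.
  - exact: idlMr.
  - exact: smul_gen.
  by rewrite scalerDr scalerA.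
have [g [w [Gg /msP[a [v [ma mv ->]]] hE]]] := H h (mem_head _ _).
have [b bE] : exists b, b * (1 - a) = 1.
  apply: mu => m1a; apply: m1; rewrite -(subrK a 1).
  exact: idlD.
have {}hE : h = b *: g + b *: v.
  rewrite -scalerDr -[h]scale1r -bE -scalerA; congr (_ *: _).
  by rewrite scalerBl scale1r {1}hE addrCA addrC addrK.
have hms : is_submodule (smul m (span [set` s])) by exact: smulP.
have sG : forall u, span [set` s] u -> G u.
  apply: IH => z zs.
  have [|g' [w' [Gg' /msP[a' [v' [ma' mv' ->]]] ->]]] := H z.
    by rewrite inE zs orbT.
  exists (g' + (a' * b) *: g), ((a' * b) *: v + v'); split.
  - by apply: smodD => //; exact: smodZ.
  - by apply: smodD => //; exact: smodZ.
  by rewrite hE scalerDr !scalerA !addrA.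
have Gh : G h.
  rewrite hE; apply: smodD => //; apply: smodZ => //; apply: sG.
  apply: smul_least mv; first exact: spanP.
  by move=> c z _ sz; apply: smodZ => //; exact: spanP.
by move=> /span_consP[c [z [/sG Gz ->]]]; apply: smodL.
Qed.

Lemma nakayama_fg (M : lmodType R) (G : set M) : local_max -> fin_gen M ->
  is_submodule G ->
  (forall u, exists g v, [/\ G g, smul m [set: M] v & u = g + v]) ->
  forall u, G u.
Proof.
move=> hm [s sT] hG H u; apply: (@nakayama M G s) => //; rewrite sT //.
Qed.

Lemma local_ring_max : noetherian R -> local_ring m -> local_max.
Proof.
move=> Rn [mm uniq]; split=> // a ma; apply: contrapT => nb.
have [||I mI JI] := @exists_maximal R (@span R R^o [set a]) Rn.
- exact: spanP.
- move=> [n [c [u [_ ua E]]]]; apply: nb; exists (\sum_(i < n) c i).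
  by rewrite E mulr_suml; apply: eq_bigr => i _; rewrite ua.
by apply: ma; rewrite -(uniq _ mI); apply: JI; apply: (@spanS _ R^o).
Qed.

End Local.

(** * Ext of the residue field *)

(** Projectivity is applied to the corestriction of d to its image; in an exact complex, [fd] then
    only asks that f land in cycles. *)
Lemma proj_lift (R : comPzRingType) (Q U V : lmodType R) (d : {linear U -> V})
    (f : {linear Q -> V}) : projective_module Q -> (forall p, exists u, f p = d u) ->
  exists g : {linear Q -> U}, forall p, d (g p) = f p.
Proof.
move=> Qp fd; pose N := [set v | exists u, v = d u].
have hN : is_submodule N.
  apply/is_submoduleP; split; first by exists 0; rewrite linear0.
  by move=> a _ _ [u ->] [v ->]; exists (a *: u + v); rewrite linearP.
have [d' d'E] := @subcorestr _ _ _ _ hN d (fun u => ex_intro _ u erefl).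
have [f' f'E] := @subcorestr _ _ _ _ hN f fd.
have [|g gE] := Qp _ _ d' f'.
  move=> v; have [u uE] := subinclP v; exists u.
  by apply: (@subincl_inj _ _ _ hN); rewrite d'E uE.
by exists g => p; rewrite -d'E gE f'E.
Qed.

Lemma divide_nzd (R : comPzRingType) (U M : lmodType R) (x : R) (f : U -> M) :
  nzd M x -> linear f -> (forall u, exists v, f u = x *: v) ->
  exists g : {linear U -> M}, forall u, f u = x *: g u.
Proof.
move=> xM fl /choice[g gE].
have gl : linear g.
  move=> a u v /=; apply/eqP; rewrite -subr_eq0; apply/eqP/xM.
  by rewrite scalerBr -gE fl !gE scalerDr !scalerA mulrC subrr.
by exists (mklin gl) => u; rewrite mklinE.
Qed.

Lemma cyclic_map (R : comPzRingType) (M : lmodType R) (u : M) :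
  exists f : {linear R^o -> M}, forall r : R, f r = r *: u.
Proof.
have fl : linear (fun r : R^o => (r : R) *: u).
  by move=> a r s; rewrite scalerDl scalerA.
by exists (mklin fl) => r; rewrite mklinE.
Qed.

Section ResidueField.
Variables (R : comPzRingType) (m : set R) (hm : is_maximal m).
Local Notation k := (residue_field hm).

Lemma residue_map (M : lmodType R) (u : M) : (forall x, m x -> x *: u = 0) ->
  exists f : {linear k -> M}, forall r : R, f (qpi (maximal_ideal hm) (r : R^o)) = r *: u.
Proof.
move=> mu; have [f fE] := cyclic_map u.
have [r /qpi_eq0 mr|g gE] :=
    @lift_surj _ _ _ _ (qpi (maximal_ideal hm)) f (@qpi_surj _ _ _ _).
  by rewrite fE mu.
by exists g => r; rewrite gE fE.
Qed.

Lemma residue_kill (x : R) (y : k) : m x -> x *: y = 0.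
Proof.
move=> mx; have [r <-] := qpi_surj y; rewrite -linearZ; apply/qpi_eq0.
exact: (idlMr (maximal_ideal hm) r mx).
Qed.

End ResidueField.

Definition socle (R : comPzRingType) (m : set R) (M : lmodType R) : set M :=
  [set u | forall x, m x -> x *: u = 0].
Arguments socle {R} m M _.

Section ExtResidue.
Variables (R : comPzRingType) (m : set R) (hm : is_maximal m).
Variable P : projective_resolution (residue_field hm).
Local Notation p_ i := (proj_obj P i).
Local Notation d i := (proj_diff P i).
Implicit Types M : lmodType R.

Lemma proj_diff2 i p : d i (d i.+1 p) = 0.
Proof. by apply/proj_exact; exists p. Qed.

(* multiplication by x on P is homotopic to zero, as x kills the residue field *)
Lemma homotopy x i : m x ->
  exists s : {linear p_ i -> p_ i.+1}, forall p, d i (s (d i p)) = x *: d i p.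
Proof.
move=> mx; elim: i => [|i [s sE]].
  have fl : linear (fun p : p_ 0%N => x *: p).
    by move=> a u v /=; rewrite scalerDr !scalerA mulrC.
  have [|p|s sE] := @proj_lift _ _ _ _ (d 0%N) (mklin fl).
  - exact: proj_objP.
  - by rewrite mklinE; apply/proj_exact0; rewrite linearZ; exact: residue_kill.
  by exists s => p; rewrite sE mklinE.
have fl : linear (fun p : p_ i.+1 => x *: p - s (d i p)).
  move=> a u v /=; rewrite (linearP (d i)) (linearP s) opprD scalerDr addrACA.
  by rewrite scalerBr !scalerA mulrC.
have [|p|t tE] := @proj_lift _ _ _ _ (d i.+1) (mklin fl).
- exact: proj_objP.
- by rewrite mklinE; apply/proj_exact; rewrite linearB linearZ sE subrr.
by exists t => p; rewrite tE mklinE proj_diff2 linear0 subr0.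
Qed.

Definition ext_vanish M (i : nat) : Prop :=
  forall f : p_ i -> M, cocycle f -> coboundary f.

(* Ext^i(k, M) is a vector space of dimension at most one over k *)
Definition ext_le1 M (i : nat) : Prop :=
  forall f1 f2 : p_ i -> M, cocycle f1 -> cocycle f2 ->
  exists a1 a2, ~ (m a1 /\ m a2) /\ coboundary (fun p => a1 *: f1 p + a2 *: f2 p).

(** With s the homotopy, x p - s (d p) is a cycle, hence a boundary, and f vanishes there; so x f is
    f s composed with d. *)
Lemma max_kill_cocycle M x i (f : p_ i -> M) : m x -> cocycle f ->
  coboundary (fun p => x *: f p).
Proof.
move=> mx; case: i f => [|i] f [fl fd].
  move=> p; have /proj_exact0[q qE] : proj_aug P (x *: p) = 0.
    by rewrite linearZ; exact: residue_kill.
  by rewrite -(mklinE fl) -linearZ qE mklinE fd.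
have [s sE] := homotopy i mx.
exists [the {linear _ -> _} of mklin fl \o s] => p /=.
have /proj_exact[q qE] : d i (x *: p - s (d i p)) = 0.
  by rewrite linearB linearZ sE subrr.
apply/eqP; rewrite -subr_eq0 -!(mklinE fl) -linearZ -linearB qE mklinE.
by rewrite fd.
Qed.

Lemma coboundary_comp M M' i (f : p_ i -> M) (g : {linear M -> M'}) :
  coboundary f -> coboundary (fun p => g (f p)).
Proof.
case: i f => [|i] f /= => [f0 p|[h hE]]; first by rewrite f0 linear0.
by exists [the {linear _ -> _} of g \o h] => p /=; rewrite hE.
Qed.

Lemma coboundary_diff M i (f : p_ i -> M) p : coboundary f -> f (d i p) = 0.
Proof.
case: i f p => [|i] f p /= => [f0|[h hE]]; first exact: f0.
by rewrite hE proj_diff2 linear0.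
Qed.

Lemma coboundary_lift M x i (f : {linear p_ i -> M}) :
  coboundary (fun p => pi1 M x (f p)) ->
  exists f0 : {linear p_ i -> M}, coboundary f0 /\
    forall p, exists v, f p - f0 p = x *: v.
Proof.
case: i f => [|i] f /= => [f0|[g gE]].
  exists [the {linear _ -> _} of \0]; split=> // p /=; rewrite subr0.
  exact/pi1_eq0.
have [||h hE] := @proj_lift _ _ _ _ (pi1 M x) g; first exact: proj_objP.
  by move=> p; have [u <-] := pi1_surj (g p); exists u.
exists [the {linear _ -> _} of h \o d i]; split; first by exists h.
by move=> p /=; apply/pi1_eq0; rewrite linearB hE gE subrr.
Qed.

(** On Ext^i(k, M) multiplication by x is zero, as x lies in m, and injective, as Ext^(i-1)(k, M/xM)
    = 0 in the long exact sequence. This gains one degree. *)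
Lemma ext_vanish_quot1_rev M x n : nzd M x -> m x ->
  (forall i, (i < n)%N -> ext_vanish (quot1 M x) i) ->
  forall i, (i < n.+1)%N -> ext_vanish M i.
Proof.
move=> xM mx H [|i] lt_in f fc; have := max_kill_cocycle mx fc.
  by move=> /= xf p; apply: xM; exact: xf.
move=> [g gE]; have [|g0 [g0c g0d]] := @coboundary_lift M x i g.
  apply: H => //; split; first by move=> a u v /=; rewrite !linearP.
  by move=> p; rewrite -gE pi1x.
have [|g' g'E] := divide_nzd xM _ g0d.
  by move=> a u v /=; rewrite !linearP /= scalerDr addrACA.
exists g' => p; apply/eqP; rewrite -subr_eq0; apply/eqP/xM.
by rewrite scalerBr gE -g'E (coboundary_diff _ g0c) subr0 subrr.
Qed.

(** The connecting map Ext^i(k, M/xM) -> Ext^(i+1)(k, M) on cocycles: lift f to g along the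
    projective module, then divide the differential of g by x. *)
Lemma connecting_lift M x i (f : p_ i -> quot1 M x) : nzd M x -> cocycle f ->
  exists (g : {linear p_ i -> M}) (f' : {linear p_ i.+1 -> M}),
    [/\ forall p, pi1 M x (g p) = f p, forall p, g (d i p) = x *: f' p & cocycle f'].
Proof.
move=> xM [fl fd].
have [||g gE] := @proj_lift _ _ _ _ (pi1 M x) (mklin fl); first exact: proj_objP.
  by move=> p; have [u <-] := pi1_surj (mklin fl p); exists u.
have [||f' f'E] := @divide_nzd _ (p_ i.+1) M x (fun p => g (d i p)) xM.
- by move=> a u v /=; rewrite !linearP.
- by move=> p; apply/pi1_eq0; rewrite gE mklinE fd.
exists g, f'; split=> //; first by move=> p; rewrite gE mklinE.
split; first by move=> a u v /=; rewrite linearP.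
by move=> p; apply: xM; rewrite -f'E proj_diff2 linear0.
Qed.

(** Injectivity of the connecting map when Ext^i(k, M) = 0: the cocycle g - x h is then a
    coboundary, and it agrees with g modulo x. *)
Lemma connecting_inj M x i (g : {linear p_ i -> M}) (f' : p_ i.+1 -> M) :
  ext_vanish M i -> (forall p, g (d i p) = x *: f' p) -> coboundary f' ->
  coboundary (fun p => pi1 M x (g p)).
Proof.
move=> Mi gd [h hE]; have hl : linear (fun p => g p - x *: h p).
  by move=> a u v /=; rewrite !linearP /= scalerDr addrACA.
have /(coboundary_comp (pi1 M x)) : coboundary (fun p => g p - x *: h p).
  by apply: Mi; split=> // p; rewrite gd hE subrr.
by congr coboundary; apply: funext => p; rewrite linearB pi1x subr0.
Qed.

Lemma ext_vanish_quot1 M x i : nzd M x -> ext_vanish M i -> ext_vanish M i.+1 ->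
  ext_vanish (quot1 M x) i.
Proof.
move=> xM Mi Mi1 f fc; have [g [f' [gE gd f'c]]] := connecting_lift xM fc.
have := connecting_inj Mi gd (Mi1 _ f'c).
by congr coboundary; apply: funext.
Qed.

Lemma ext_le1_quot1 M x i : nzd M x -> ext_vanish M i -> ext_le1 M i.+1 ->
  ext_le1 (quot1 M x) i.
Proof.
move=> xM Mi M1 f1 f2 f1c f2c.
have [g1 [f1' [g1E g1d f1'c]]] := connecting_lift xM f1c.
have [g2 [f2' [g2E g2d f2'c]]] := connecting_lift xM f2c.
have [a1 [a2 [a12 cob]]] := M1 _ _ f1'c f2'c; exists a1, a2; split=> //.
have gl : linear (fun p => a1 *: g1 p + a2 *: g2 p).
  move=> a u v /=; rewrite (linearP g1) (linearP g2) !scalerDr addrACA !scalerA.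
  by rewrite [a1 * _]mulrC [a2 * _]mulrC.
have gd p : mklin gl (d i p) = x *: (a1 *: f1' p + a2 *: f2' p).
  by rewrite mklinE g1d g2d scalerDr !scalerA ![x * _]mulrC.
have := connecting_inj Mi gd cob; congr coboundary; apply: funext => p.
by rewrite mklinE linearD !linearZ -g1E -g2E.
Qed.

Lemma ext_vanish_weak_regular M xs : weak_regular M xs -> (forall x, x \in xs -> m x) ->
  forall i, (i < size xs)%N -> ext_vanish M i.
Proof.
elim: xs M => [|x xs IH] M //= [xM Mxs] mxs.
apply: ext_vanish_quot1_rev xM _ _; first by apply: mxs; rewrite mem_head.
by apply: IH => // y ys; apply: mxs; rewrite inE ys orbT.
Qed.

Lemma ext_vanish_quot_seq M xs n : weak_regular M xs ->
  (forall i, (i < size xs + n)%N -> ext_vanish M i) ->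
  forall i, (i < n)%N -> ext_vanish (quot_seq M xs) i.
Proof.
elim: xs M => [|x xs IH] M //= [xM Mxs] Mv i lt_in.
apply: IH => // j lt_j; apply: ext_vanish_quot1 => //; apply: Mv => //.
by rewrite addSn ltnS ltnW.
Qed.

(** Each term of [xs] lowers the degree by one along an injective connecting map; in degree zero Ext
    is Hom(k, -), which is the socle. *)
Lemma ext_le1_quot_seq M xs : weak_regular M xs ->
  (forall i, (i < size xs)%N -> ext_vanish M i) ->
  ext_le1 M (size xs) -> ext_le1 (quot_seq M xs) 0.
Proof.
elim: xs M => [|x xs IH] M //= [xM Mxs] Mv M1.
apply: IH => // [i lt_i|]; last by apply: ext_le1_quot1 => //; apply: Mv.
by apply: ext_vanish_quot1 => //; apply: Mv; rewrite // ltnW.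
Qed.

Lemma socle_cocycle M u : socle m M u ->
  exists2 f : p_ 0%N -> M, cocycle f & exists p, f p = u.
Proof.
move=> us; have [g gE] := residue_map hm us.
exists (fun p => g (proj_aug P p)).
  split; first by move=> a v w; rewrite !linearP.
  move=> p; have -> : proj_aug P (d 0%N p) = 0 by apply/proj_exact0; exists p.
  by rewrite linear0.
have [p pE] := proj_augP P (qpi (maximal_ideal hm) (1 : R^o)).
by exists p; rewrite pE gE scale1r.
Qed.

Lemma ext_vanish0_socle M u : ext_vanish M 0 -> socle m M u -> u = 0.
Proof. by move=> M0 /socle_cocycle[f fc [p <-]]; apply: (M0 f fc p). Qed.

Lemma ext_le1_socle M u v : ext_le1 M 0 -> socle m M u -> socle m M v ->
  exists a b, ~ (m a /\ m b) /\ a *: u + b *: v = 0.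
Proof.
move=> M1 us vs; have [f fE] := residue_map hm us; have [g gE] := residue_map hm vs.
have cc (h : {linear residue_field hm -> M}) :
    cocycle (fun p : p_ 0%N => h (proj_aug P p)).
  split; first by move=> a w z /=; rewrite !linearP.
  move=> p; have -> : proj_aug P (d 0%N p) = 0 by apply/proj_exact0; exists p.
  by rewrite linear0.
have [a [b [ab cob]]] := M1 _ _ (cc f) (cc g).
exists a, b; split=> //.
have [p pE] := proj_augP P (qpi (maximal_ideal hm) (1 : R^o)).
by have := cob p; rewrite /= pE fE gE !scale1r.
Qed.

End ExtResidue.

(** Linear dependence of any two classes passes through connecting maps without tracking a basis;
    nonvanishing is what later excludes a degree smaller than the length of the sequence. *)
Lemma ext_residue_dim1 (R : comPzRingType) (m : set R) (hm : is_maximal m)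
    (M : lmodType R) (n : nat) : ext_residue_dim hm M n 1 ->
  exists P : projective_resolution (residue_field hm),
    ext_le1 P M n /\ ~ ext_vanish P M n.
Proof.
move=> [P [e [ec espan efree]]]; exists P; split; last first.
  move=> Mn; have [_ m1 _] := hm; apply: m1.
  have := efree (fun=> 1) _ ord0; apply.
  have := Mn _ (ec ord0); congr coboundary; apply: funext => x.
  by rewrite big_ord1 scale1r.
move=> f1 f2 f1c f2c.
have [a aE] := espan _ f1c; have [b bE] := espan _ f2c.
have add i (g h : proj_obj P i -> M) : coboundary g -> coboundary h ->
    coboundary (fun x => g x + h x).
  case: i g h => [|i] g h /= => [g0 h0 x|[g' g'E] [h' h'E]].
    by rewrite g0 h0 addr0.
  by exists [the {linear _ -> _} of g' \+ h'] => x /=; rewrite g'E h'E.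
have scale i (g : proj_obj P i -> M) c : coboundary g ->
    coboundary (fun x => c *: g x).
  case: i g => [|i] g /= => [g0 x|[g' g'E]]; first by rewrite g0 scaler0.
  have gl : linear (fun p => c *: g' p).
    by move=> r u v /=; rewrite linearP scalerDr !scalerA mulrC.
  by exists (mklin gl) => x /=; rewrite mklinE g'E.
have m1 := let: And3 _ m1 _ := hm in m1.
(* Modulo coboundaries, f1 is a e and f2 is b e. If a lies in m, then a e, hence f1, is a
   coboundary; otherwise - b f1 + a f2 cancels e and has a coefficient outside m. *)
have [ma|ma] := pselect (m (a ord0)).
  exists 1, 0; split; first by case.
  have := add _ _ _ aE (max_kill_cocycle ma (ec ord0)).
  congr coboundary; apply: funext => x.
  by rewrite big_ord1 subrK scale1r scale0r addr0.
exists (- b ord0), (a ord0); split; first by case.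
have := add _ _ _ (scale _ _ (- b ord0) aE) (scale _ _ (a ord0) bE).
congr coboundary; apply: funext => x.
rewrite !big_ord1 !scalerBr addrACA -[RHS]addr0; congr (_ + _).
by rewrite !scalerA mulNr scaleNr opprK mulrC subrr.
Qed.

(** * Prime avoidance and dimension *)

Definition ann (R : comPzRingType) (M : lmodType R) (u : M) : set R :=
  [set a | a *: u = 0].

Lemma ann_ideal (R : comPzRingType) (M : lmodType R) (u : M) : is_ideal (ann u).
Proof.
apply/is_submoduleP; split; first exact: scale0r.
by move=> c a b /= au bu; rewrite /ann/= scalerDl -scalerA au bu scaler0 addr0.
Qed.

Section Annihilators.
Variables (R : comPzRingType) (Rn : noetherian R) (M : lmodType R).
Implicit Types (u v w : M) (J : set R).

Definition max_ann u : Prop :=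
  u <> 0 /\ forall v, v <> 0 -> ann u `<=` ann v -> ann v = ann u.

Lemma max_ann_above w : w <> 0 -> exists2 u, max_ann u & ann w `<=` ann u.
Proof.
move=> w0.
have [|I [u [_ <- _]]|I [[u [u0 uI wu]] Imax]] := @noeth_max R Rn
    [set I | exists u, [/\ u <> 0, ann u = I & ann w `<=` I]].
- by exists (ann w), w; split=> // a.
- exact: ann_ideal.
exists u; last by rewrite uI.
split=> // v v0 uv; rewrite uI; apply: Imax; last by rewrite -uI.
by exists v; split=> //; apply: subset_trans uv; rewrite uI.
Qed.

(** This is the primality of [ann u]: [ann (b *: u)] contains [ann u], so maximality makes them
    equal. *)
Lemma max_annM u a b : max_ann u -> a *: u <> 0 -> b *: u <> 0 -> (a * b) *: u <> 0.
Proof.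
move=> [u0 um] au bu abu; apply: au.
have E := um _ bu _; suff : ann (b *: u) a.
  rewrite E // => c cu; rewrite /ann/= scalerA mulrC -scalerA.
  by rewrite (cu : c *: u = 0) scaler0.
by rewrite /ann/= scalerA.
Qed.

(** Maximality is taken only among annihilators of multiples of w, because the application needs the
    associated prime to come from a multiple of the given element. *)
Lemma assoc_multiple w : w <> 0 -> exists2 r, r *: w <> 0 & is_prime (ann (r *: w)).
Proof.
move=> w0.
have [||I [[r [r0 rI]] Imax]] := @noeth_max R Rn
    [set I | exists r, r *: w <> 0 /\ ann (r *: w) = I].
- by exists (ann w), 1; rewrite scale1r.
- by move=> _ [r [_ <-]]; exact: ann_ideal.
exists r => //; split; first exact: ann_ideal.
  by rewrite /ann/= scale1r.
move=> a b abr; have [br|br] := pselect (b *: (r *: w) = 0); [by right|left].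
have E : ann ((b * r) *: w) = I.
  apply: Imax; first by exists (b * r); rewrite -scalerA.
  rewrite -rI => c; rewrite /ann/= => cr.
  have -> : c *: ((b * r) *: w) = b *: (c *: (r *: w)).
    by rewrite !scalerA; congr (_ *: _); ring.
  by rewrite cr scaler0.
by rewrite rI -E; move: abr; rewrite /ann/= !scalerA mulrA.
Qed.

(* the product of the separating elements works, as [ann v] is prime *)
Lemma separate_ann J v (us : seq M) : is_ideal J -> max_ann v ->
  (exists2 a, J a & a *: v <> 0) ->
  (forall u, u \in us -> exists2 b, b *: u = 0 & b *: v <> 0) ->
  exists y, [/\ J y, y *: v <> 0 & forall u, u \in us -> y *: u = 0].
Proof.
move=> hJ vm [a Ja av]; elim: us => [|u us IH] H; first by exists a.
have [|y [Jy yv yus]] := IH; first by move=> u' us'; apply: H; rewrite inE us' orbT.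
have [b bu bv] := H u (mem_head _ _).
exists (y * b); split; first exact: idlMr.
  exact: max_annM.
move=> u'; rewrite inE => /orP[/eqP->|/yus yu']; first by rewrite -scalerA bu scaler0.
by rewrite mulrC -scalerA yu' scaler0.
Qed.

(** If the x found for [us] kills the new u, add some y in J that kills all of [us] but not u. Such
    y exists: were [ann v] inside [ann u] for some v in [us], maximality would make them equal, and
    x would kill v. *)
Lemma avoid_max_ann J (us : seq M) : is_ideal J ->
  (forall u, u \in us -> max_ann u /\ exists2 a, J a & a *: u <> 0) ->
  exists2 x, J x & forall u, u \in us -> x *: u <> 0.
Proof.
move=> hJ; elim: us => [|u us IH] H; first by exists 0 => //; exact: idl0.
have [|x Jx xus] := IH; first by move=> u' us'; apply: H; rewrite inE us' orbT.
have [um uJ] := H u (mem_head _ _).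
have [xu|xu] := pselect (x *: u = 0); last first.
  by exists x => // v; rewrite inE => /orP[/eqP->|/xus].
have [|y [Jy yu yus]] := separate_ann hJ um uJ (us := us).
  move=> v vs; apply: contrapT => nb; apply: (xus v vs).
  have [|vm _] := H v; first by rewrite inE vs orbT.
  have vu : ann v `<=` ann u.
    by move=> b bv; apply: contrapT => bu; apply: nb; exists b.
  have E := vm.2 _ um.1 vu.
  suff : ann v x by [].
  by rewrite -E.
exists (x + y); first exact: idlD.
move=> v; rewrite inE scalerDl => /orP[/eqP->|vs]; first by rewrite xu add0r.
by rewrite yus // addr0; exact: xus.
Qed.

(* The zero divisors on M lie in finitely many maximal annihilators: those of a
   finite set of generators of the submodule spanned by all u with [max_ann u]. *)
Lemma exists_nzd J : fin_gen M -> is_ideal J ->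
  (forall u, socle J M u -> u = 0) -> exists2 x, J x & nzd M x.
Proof.
move=> Mfg hJ socJ.
have [s sE] := noeth_fin_gen Rn Mfg (spanP (max_ann : set M)).
have [us usm sus] : exists2 us : seq M, (forall u, u \in us -> max_ann u) &
    forall u, u \in s -> span [set` us] u.
  have : forall u, u \in s -> span (max_ann : set M) u.
    by move=> u us; rewrite sE; apply: spanS.
  elim: (s) => [|u s' IH] H; first by exists [::].
  have [|us usm sus] := IH; first by move=> v vs; apply: H; rewrite inE vs orbT.
  have [n [a [v [_ vm uE]]]] := H u (mem_head _ _).
  exists ([seq v i | i <- enum 'I_n] ++ us).
    by move=> w; rewrite mem_cat => /orP[/mapP[i _ ->]|/usm].
  move=> w; rewrite inE => /orP[/eqP->|/sus].
    rewrite uE; apply: smod_sum => [|i _]; first exact: spanP.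
    apply: smodZ; first exact: spanP.
    by apply: spanS; rewrite /= mem_cat map_f // mem_enum.
  by apply: span_sub => z zs; rewrite mem_cat zs orbT.
have [|x Jx xus] := avoid_max_ann hJ (us := us).
  move=> u uus; have um := usm u uus; split=> //.
  apply: contrapT => nJ; apply: um.1; apply: socJ => a Ja.
  by apply: contrapT => au; apply: nJ; exists a.
(* If x kills w, it kills some v with maximal annihilator. No [ann u] with u in [us] lies inside
   [ann v], so some y kills all of [us] but not v, although v is in their span. *)
exists x => // w xw; apply: contrapT => w0.
have [v vm wv] := max_ann_above w0.
have [||y [_ yv yus]] := @separate_ann setT v us (smodT R^o) vm.
- by exists 1 => //; rewrite scale1r; exact: vm.1.
- move=> u uus; apply: contrapT => nb; apply: (xus u uus).
  suff : ann u x by [].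
  have uv : ann u `<=` ann v.
    by move=> b bu; apply: contrapT => bv; apply: nb; exists b.
  rewrite -((usm u uus).2 v vm.1 uv); exact: wv.
apply: yv; have : span [set` s] v by rewrite -sE; apply: spanS.
have hy : is_submodule [set z : M | y *: z = 0].
  apply/is_submoduleP; split; first exact: scaler0.
  by move=> c z z' /= yz yz'; rewrite scalerDr yz' addr0 scalerA mulrC -scalerA yz scaler0.
apply: (span_least hy) => u us'.
by apply: (span_least hy) (sus u us') => z /yus.
Qed.

End Annihilators.

Lemma fin_gen_pair (R : comPzRingType) (M N : lmodType R) :
  fin_gen M -> fin_gen N -> fin_gen (M * N)%type.
Proof.
move=> [s sT] [t tT]; set l := [seq (u, 0 : N) | u <- s] ++ [seq (0 : M, v) | v <- t].
exists l; apply/seteqP; split=> // -[u v] _.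
have hl : is_submodule (span [set` l]) by exact: spanP.
have -> : (u, v) = (u, 0) + (0, v) by apply: injective_projections; rewrite /= ?addr0 ?add0r.
apply: smodD => //.
  have : span [set` s] u by rewrite sT.
  apply: (@span_least _ _ _ [set u | span [set` l] (u, 0)]).
    apply/is_submoduleP; split; first exact: (smod0 hl).
    move=> a w z /= wl zl.
    have -> : (a *: w + z, 0) = a *: (w, 0 : N) + (z, 0).
      by apply: injective_projections; rewrite /= ?scaler0 ?addr0.
    exact: smodL.
  by move=> w /= ws; apply: spanS; rewrite /= mem_cat map_f.
have : span [set` t] v by rewrite tT.
apply: (@span_least _ _ _ [set v | span [set` l] (0, v)]).
  apply/is_submoduleP; split; first exact: (smod0 hl).
  move=> a w z /= wl zl.
  have -> : (0, a *: w + z) = a *: (0 : M, w) + (0, z).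
    by apply: injective_projections; rewrite /= ?scaler0 ?addr0.
  exact: smodL.
by move=> w /= ws; apply: spanS; rewrite /= mem_cat (map_f (pair 0)) ?orbT.
Qed.

Lemma common_regular_seq (R : comPzRingType) (m : set R) (hm : is_maximal m)
    (P : projective_resolution (residue_field hm)) (M1 M2 M3 : lmodType R) n :
  noetherian R -> fin_gen M1 -> fin_gen M2 -> fin_gen M3 ->
  (forall i, (i < n)%N -> [/\ ext_vanish P M1 i, ext_vanish P M2 i & ext_vanish P M3 i]) ->
  exists xs, [/\ size xs = n, forall x, x \in xs -> m x &
    [/\ weak_regular M1 xs, weak_regular M2 xs & weak_regular M3 xs]].
Proof.
move=> Rn; elim: n M1 M2 M3 => [|n IH] M1 M2 M3 f1 f2 f3 H.
  by exists [::].
(* Avoidance is applied to the product of the three modules: its socle vanishes with theirs, and a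
   nonzerodivisor on it is one on each factor. *)
have [x mx xM] : exists2 x, m x & nzd (M1 * (M2 * M3))%type x.
  apply: exists_nzd => //; first by do !apply: fin_gen_pair.
    exact: maximal_ideal.
  have [v1 v2 v3] := H 0%N isT.
  move=> [u1 [u2 u3]] us.
  by congr (_, (_, _)); [apply: (ext_vanish0_socle v1)|
    apply: (ext_vanish0_socle v2)|apply: (ext_vanish0_socle v3)] => y my;
    have := us y my => -[].
have x1 : nzd M1 x.
  move=> u xu; have [] // : (u, (0 : M2, 0 : M3)) = 0.
  by apply: xM; congr (_, (_, _)); rewrite //= scaler0.
have x2 : nzd M2 x.
  move=> u xu; have [] // : (0 : M1, (u, 0 : M3)) = 0.
  by apply: xM; congr (_, (_, _)); rewrite //= scaler0.
have x3 : nzd M3 x.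
  move=> u xu; have [] // : (0 : M1, (0 : M2, u)) = 0.
  by apply: xM; congr (_, (_, _)); rewrite //= scaler0.
have [|||i lt_i|xs [xsn xsm [r1 r2 r3]]] := IH (quot1 M1 x) (quot1 M2 x) (quot1 M3 x).
- exact: fin_gen_quot1.
- exact: fin_gen_quot1.
- exact: fin_gen_quot1.
- have [v1 v2 v3] := H i (ltnW lt_i); have [w1 w2 w3] := H i.+1 lt_i.
  by split; apply: ext_vanish_quot1.
exists (x :: xs); split=> /=; first by rewrite xsn.
  by move=> y; rewrite inE => /orP[/eqP->|/xsm].
by [].
Qed.

Section Dimension.
Variables (R : comPzRingType) (Rn : noetherian R).

(** A cyclic module stands for the ring R / Ann N, so that the base ring stays fixed while the terms
    of a sequence are divided out. *)
Definition cyclic (N : lmodType R) (e : N) : Prop := forall u, exists r, u = r *: e.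

Lemma cyclic_quot1 (N : lmodType R) (e : N) x : cyclic e -> cyclic (pi1 N x e).
Proof.
move=> eN y; have [u <-] := pi1_surj y; have [r ->] := eN u.
by exists r; rewrite linearZ.
Qed.

Lemma cyclic_ann (N : lmodType R) (e : N) a : cyclic e ->
  annihilator N a <-> a *: e = 0.
Proof.
move=> eN; split=> [|ae u _]; first by apply.
by have [r ->] := eN u; rewrite /= scalerA mulrC -scalerA ae scaler0.
Qed.

Lemma annihilator_quot1 (N : lmodType R) x : annihilator N `<=` annihilator (quot1 N x).
Proof.
move=> a aN y _; have [u <-] := pi1_surj y.
by rewrite /= -linearZ (aN u) ?linear0.
Qed.

(** The chain is extended downwards. The prime p_0 contains x and Ann N; as x is a nonzerodivisor on
    N, no x^n s with s outside p_0 lies in Ann N, so some prime over Ann N avoids all these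
    products. It lies inside p_0 and misses x. *)
Lemma prime_chain_quot1 (N : lmodType R) (e : N) x t p : cyclic e -> nzd N x ->
  prime_chain (quot1 N x) t p -> exists p', prime_chain N t.+1 p'.
Proof.
move=> eN xN [pP pS]; have [[q0i q01 q0M] q0A] := pP 0%N isT; set q0 := p 0%N in q0i q01 q0M q0A.
have Aq0 : annihilator N `<=` q0.
  by apply: subset_trans q0A; exact: annihilator_quot1.
(* an ideal maximal among those disjoint from the products x^n s, s outside q0 *)
pose Q := [set I : set R | [/\ is_ideal I, annihilator N `<=` I &
  forall n s, ~ q0 s -> ~ I (x ^+ n * s)]].
have [||q [[qi qA qS] qmax]] := @noeth_max R Rn Q.
- exists (annihilator N); split=> //.
    apply/is_submoduleP; split; first by move=> u _; rewrite /= scale0r.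
    by move=> c a b ha hb u _; rewrite /= scalerDl -scalerA (ha u) // (hb u) // scaler0 addr0.
  move=> n s q0s /(cyclic_ann _ eN) xs; apply/q0s/Aq0/(cyclic_ann _ eN).
  elim: n xs => [|n IH]; first by rewrite mul1r.
  by rewrite exprS -mulrA -scalerA => /xN.
- by move=> I [].
have adj a : ~ q a -> exists n s i r, [/\ ~ q0 s, q i & x ^+ n * s = i + r * a].
  move=> qa; apply: contrapT => nS; apply: qa.
  pose J := [set z | exists i r, q i /\ z = i + r * a].
  have <- : J = q.
    apply: qmax; last by move=> z qz; exists z, 0; rewrite mul0r addr0.
    split; last first.
    - move=> n s q0s [i [r [qi' E]]]; apply: nS; exists n, s, i, r; split=> //.
    - by move=> z /qA qz; exists z, 0; rewrite mul0r addr0.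
    apply/is_submoduleP; split.
      by exists 0, 0; rewrite mul0r addr0; split=> //; exact: idl0.
    move=> c _ _ [i [r [hi ->]]] [j [s [hj ->]]]; exists (c * i + j), (c * r + s).
    split; first by apply: idlD => //; exact: idlM.
    by rewrite /GRing.scale/=; ring.
  by exists 0, 1; rewrite mul1r add0r; split=> //; exact: idl0.
have qprime : is_prime q.
  split=> //; first by have := qS 0%N 1 q01; rewrite mul1r.
  move=> a b qab; apply: contrapT => /not_orP[/adj[n [s [i [r [q0s hi E]]]]]].
  move=> /adj[k [t' [j [r' [q0t hj E']]]]].
  have : ~ q0 (s * t') by move=> /q0M[].
  move=> /(qS (n + k)%N); apply.
  have -> : x ^+ (n + k) * (s * t') = (x ^+ n * s) * (x ^+ k * t') by rewrite exprD; ring.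
  rewrite E E'.
  have -> : (i + r * a) * (j + r' * b) =
    (j + r' * b) * i + (r * a * j + (r * r') * (a * b)) by ring.
  by do !apply: idlD => //; exact: idlM.
exists (fun i => if i is i'.+1 then p i' else q); split.
  case=> [|i] le_i; first by [].
  have [? ?] := pP i le_i; split=> //.
  by apply: subset_trans (@annihilator_quot1 N x) _.
case=> [_|i lt_i]; last exact: pS.
rewrite properEneq; split.
  apply/eqP => E; have := qS 1%N 1 q01; rewrite mulr1 expr1; apply.
  rewrite E; apply: q0A => y _; exact: quot1x.
move=> a qa; apply: contrapT => q0a.
by have := qS 0%N a q0a; rewrite mul1r.
Qed.

Lemma prime_chain_quot_seq (N : lmodType R) (e : N) xs t p : cyclic e -> weak_regular N xs ->
  prime_chain (quot_seq N xs) t p -> exists p', prime_chain N (t + size xs) p'.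
Proof.
elim: xs N e => [|x xs IH] N e eN /=; first by rewrite addn0; exists p.
move=> [xN wN] /(IH _ _ (cyclic_quot1 (x := x) eN) wN)[p' /(prime_chain_quot1 eN xN)].
by rewrite addnS.
Qed.

(** Otherwise p < m is a chain of length 1 over the quotient, and it lengthens to one of length 1 +
    [size xs] over N. *)
Lemma prime_regular_max (m : set R) (N : lmodType R) (e : N) xs p :
  local_max m -> cyclic e -> weak_regular N xs ->
  (forall k q, prime_chain N k q -> (k <= size xs)%N) ->
  is_prime p -> annihilator (quot_seq N xs) `<=` p -> p = m.
Proof.
move=> [mm mu] eN wN dimN pp Ap.
have pm : p `<=` m.
  move=> a pa; apply: contrapT => /mu[b ba].
  by have [pI p1 _] := pp; apply: p1; rewrite -ba; exact: idlM.
apply: contrapT => npm.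
have [|q /dimN] := @prime_chain_quot_seq N e xs 1 (fun i => if i is _.+1 then m else p) eN wN.
  split=> [[|i] _|[|i] //= _]; first by split.
    by split; [exact: maximal_prime|exact: subset_trans pm].
  by rewrite properEneq; split=> //; apply/eqP.
by rewrite add1n ltnn.
Qed.

(** This replaces the Artinian property of the quotient: a suitable multiple of w has a prime
    annihilator, and m is the only prime available. *)
Lemma socle_multiple (m : set R) (N : lmodType R) (e : N) xs (W : lmodType R) (w : W) :
  local_max m -> cyclic e -> weak_regular N xs ->
  (forall k q, prime_chain N k q -> (k <= size xs)%N) ->
  annihilator (quot_seq N xs) `<=` annihilator W -> w <> 0 ->
  exists2 r, r *: w <> 0 & socle m W (r *: w).
Proof.
move=> lm eN wN dimN AW w0; have [r rw rp] := assoc_multiple Rn w0.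
exists r => //; suff E : ann (r *: w) = m by move=> x; rewrite -E.
by apply: (prime_regular_max lm eN wN dimN rp) => a /AW aW; exact: aW.
Qed.

End Dimension.

(** * Injectivity over quotient rings *)

Section RelativeInjective.
Variable R : comPzRingType.
Implicit Types (J : set R) (M N E F Q T U V W Y Z : lmodType R).

(* injectivity over R / J, for modules killed by J *)
Definition rel_inj J E : Prop :=
  J `<=` annihilator E /\
  forall U V (i : {linear U -> V}) (f : {linear U -> E}),
    J `<=` annihilator V -> injective i ->
    exists g : {linear V -> E}, forall u, g (i u) = f u.

(* injective dimension at most n over R / J *)
Fixpoint rel_inj_dim J n M : Prop :=
  if n is n'.+1 then
    exists E Q (i : {linear M -> E}) (q : {linear E -> Q}),
      [/\ injective i, forall y, exists e, q e = y, is_exact i q,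
          rel_inj J E & rel_inj_dim J n' Q]
  else rel_inj J M.

Lemma killed J E a : J `<=` annihilator E -> J a -> forall u : E, a *: u = 0.
Proof. by move=> JE /JE aE u; exact: aE. Qed.

Lemma linear_inj U V (i : {linear U -> V}) : (forall u, i u = 0 -> u = 0) -> injective i.
Proof.
move=> i0 u v uv; apply/eqP; rewrite -subr_eq0; apply/eqP/i0.
by rewrite linearB uv subrr.
Qed.

Lemma inj_eq0 U V (i : {linear U -> V}) u : injective i -> i u = 0 -> u = 0.
Proof. by move=> ii iu; apply: ii; rewrite iu linear0. Qed.

Lemma rel_inj_trivial J E : trivial_module E -> rel_inj J E.
Proof.
move=> E0; split; first by move=> a _ u _; apply: E0.
move=> U V i f _ _; exists [the {linear _ -> _} of \0] => u /=.
by rewrite (E0 (f u)).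
Qed.

Lemma rel_inj_dimS J n M : rel_inj_dim J n M -> rel_inj_dim J n.+1 M.
Proof.
elim: n M => [|n IH] M; last first.
  by move=> [E [Q [i [q [ii qs ex Ei /IH Qi]]]]]; exists E, Q, i, q.
move=> MI; set Z : lmodType R := submodule (smod_set0 M).
have Z0 : trivial_module Z.
  by move=> z; apply: (@subincl_inj _ _ _ (smod_set0 M)); rewrite linear0 (subinclP z).
exists M, Z, [the {linear _ -> _} of idfun], [the {linear _ -> _} of \0].
split=> //=.
- by move=> y; exists 0; rewrite (Z0 y).
- by move=> v; split=> // _; exists v.
- exact: rel_inj_trivial.
Qed.

Lemma ker_submodule U V (f : {linear U -> V}) : is_submodule [set u | f u = 0].
Proof.
apply/is_submoduleP; split; first exact: linear0.
by move=> a u v /= fu fv; rewrite linearP fu fv scaler0 addr0.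
Qed.

Lemma image_submodule U V (f : {linear U -> V}) : is_submodule [set v | exists u, v = f u].
Proof.
apply/is_submoduleP; split; first by exists 0; rewrite linear0.
by move=> a _ _ [u ->] [v ->]; exists (a *: u + v); rewrite linearP.
Qed.

Lemma annihilator_regular M : annihilator R^o `<=` annihilator M.
Proof.
move=> a /(_ (1 : R^o) I) a0 u _.
have -> : a = 0 by rewrite -a0 /GRing.scale/= mulr1.
exact: scale0r.
Qed.

Lemma fin_inj_dim_rel M : fin_inj_dim M -> exists n, rel_inj_dim (annihilator R^o) n M.
Proof.
move=> [E [n En]]; set J := annihilator _.
have Einj i : rel_inj J (inj_obj E i).
  split=> [|U V f g _]; first exact: annihilator_regular.
  exact: inj_objP.
(* The resolution is cut into short exact sequences 0 -> K i -> E_i -> K (i+1) -> 0, and K i is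
   trivial once i > n. *)
pose K i := submodule (ker_submodule (inj_diff E i)).
have kerK k i : (n < i + k)%N -> rel_inj_dim J k (K i).
  elim: k i => [|k IH] i.
    rewrite addn0 => /En Ei; apply: rel_inj_trivial => u.
    apply: (@subincl_inj _ _ _ (ker_submodule (inj_diff E i))).
    by rewrite (Ei (subincl _ _)) linear0.
  rewrite addnS -addSn => /IH Ki.
  have [|q qE] := @subcorestr _ _ _ _ (ker_submodule (inj_diff E i.+1)) (inj_diff E i).
    by move=> u /=; apply/inj_exact; exists u.
  exists (inj_obj E i), (K i.+1), (subincl _), q; split=> //.
  - exact: subincl_inj.
  - move=> y; have /inj_exact[e eE] := subinclP y; exists e.
    by apply: subincl_inj; rewrite qE eE.
  - move=> v; split=> [qv|[u ->]].
      have := qE v; rewrite qv linear0 => /esym dv.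
      by have [u uE] := subincl_surj (ker_submodule (inj_diff E i)) dv; exists u.
    by apply: subincl_inj; rewrite qE linear0; exact: (subinclP u).
exists n.+2.
have [|q qE] := @subcorestr _ _ _ _ (ker_submodule (inj_diff E 1)) (inj_diff E 0).
  by move=> u /=; apply/inj_exact; exists u.
exists (inj_obj E 0), (K 1%N), (inj_aug E), q; split=> //.
- exact: inj_augP.
- move=> y; have /inj_exact[e eE] := subinclP y; exists e.
  by apply: subincl_inj; rewrite qE eE.
- move=> v; rewrite -inj_exact0 -qE; split=> [->|]; first by rewrite linear0.
  by move=> /inj_eq0; apply; exact: subincl_inj.
- by apply: kerK; rewrite addnC addn1.
Qed.

(** * Change of rings along a nonzerodivisor *)

Section ChangeOfRings.
Variables (N : lmodType R) (e : N) (eN : cyclic e) (x : R) (xN : nzd N x).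
Local Notation J := (annihilator N).
Local Notation J' := (annihilator (quot1 N x)).

Lemma torsP E : is_submodule [set u : E | x *: u = 0].
Proof.
apply/is_submoduleP; split; first exact: scaler0.
by move=> a u v /= xu xv; rewrite scalerDr xv addr0 scalerA mulrC -scalerA xu scaler0.
Qed.

(** This is Hom(R/x, E), the functor that carries injective modules over R / Ann N to injective
    modules over the quotient by x. *)
Definition tors E : lmodType R := submodule (torsP E).
Local Notation tin E := (subincl (torsP E)).

Lemma tors_map E Q (f : {linear E -> Q}) :
  exists g : {linear tors E -> tors Q}, forall u, tin Q (g u) = f (tin E u).
Proof.
have [|g gE] := @subcorestr _ _ _ _ (torsP Q) [the {linear _ -> _} of f \o tin E].
  by move=> u /=; rewrite -linearZ (subinclP u) linear0.
by exists g.
Qed.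

(** A module killed by J' is killed by x, so any extension of a map from it to E lands in the
    x-torsion by itself. *)
Lemma rel_inj_tors E : rel_inj J E -> rel_inj J' (tors E).
Proof.
move=> [JE Einj]; split.
  move=> a aJ' u _; apply: (@subincl_inj _ _ _ (torsP E)); rewrite linearZ linear0 /=.
  have /pi1_eq0[v vE] : pi1 N x (a *: e) = 0 by rewrite linearZ; exact: (aJ' _ I).
  have [s sE] := eN v.
  have /JE aE : J (a - s * x).
    apply/(cyclic_ann _ eN).
    by rewrite scalerBl vE sE !scalerA mulrC subrr.
  rewrite -(subrK (s * x) a) scalerDl (aE _ I : _ *: _ = 0) add0r -scalerA.
  by rewrite (subinclP u : x *: _ = 0) scaler0.
move=> U V i f JV ii.
have [|g gE] := Einj U V i [the {linear _ -> _} of tin E \o f] _ ii.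
  by apply: subset_trans JV; exact: annihilator_quot1.
have [|g' g'E] := @subcorestr _ _ _ _ (torsP E) g.
  move=> v /=; rewrite -linearZ (JV x) ?linear0 // => y _.
  exact: quot1x.
by exists g' => u; apply: subincl_inj; rewrite g'E gE.
Qed.

(** The map N -> E with e sent to y extends along the injective multiplication by x on N; the image
    of e under the extension is the required quotient. *)
Lemma rel_inj_divisible E : rel_inj J E -> forall y : E, exists z, y = x *: z.
Proof.
move=> [JE Einj] y.
have [f0 f0E] := cyclic_map y; have [q qE] := cyclic_map e.
have [||f fE] := @lift_surj _ _ _ _ q f0.
- by move=> u; have [r ->] := eN u; exists r; rewrite qE.
- move=> r; rewrite qE f0E => /(cyclic_ann _ eN)/JE; exact.
have il : linear (fun u : N => x *: u).
  by move=> a u v /=; rewrite scalerDr !scalerA mulrC.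
have [||g gE] := Einj _ _ (mklin il) f => //.
  by apply: linear_inj => u; rewrite mklinE => /xN.
exists (g e); rewrite -linearZ -(mklinE il) gE.
have := fE (1 : R^o); rewrite qE f0E !scale1r; exact: esym.
Qed.

(** When Q = xQ, taking x-torsion keeps 0 -> Q -> E -> Q2 -> 0 exact: a lift to E of a torsion
    element is corrected by an element of Q. Divisibility passes from E to Q2. *)
Lemma rel_inj_dim_tors n Q : rel_inj_dim J n Q -> (forall y : Q, exists z, y = x *: z) ->
  rel_inj_dim J' n (tors Q).
Proof.
elim: n Q => [|n IH] Q; first by move=> /rel_inj_tors.
move=> [E [Q2 [i [q [ii qs ex Ei Q2i]]]]] Qdiv.
have [i' i'E] := tors_map i; have [q' q'E] := tors_map q.
have tI U : injective (tin U) by exact: subincl_inj.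
exists (tors E), (tors Q2), i', q'; split.
- apply: linear_inj => u iu; apply: tI; apply: ii.
  by rewrite -i'E iu !linear0.
- move=> y; have [e0 e0E] := qs (tin Q2 y).
  have /ex[u uE] : q (x *: e0) = 0 by rewrite linearZ e0E; exact: (subinclP y).
  have [u' u'E] := Qdiv u.
  have [|e1 e1E] := subincl_surj (torsP E) (u := e0 - i u').
    by rewrite /= scalerBr uE u'E linearZ subrr.
  exists e1; apply: tI; rewrite q'E e1E linearB e0E.
  have -> : q (i u') = 0 by apply/ex; exists u'.
  exact: subr0.
- move=> v; split=> [qv|[u ->]]; last first.
    by apply: tI; rewrite q'E i'E linear0; apply/ex; exists (tin Q u).
  have /ex[u uE] : q (tin E v) = 0 by rewrite -q'E qv linear0.
  have [|u1 u1E] := subincl_surj (torsP Q) (u := u).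
    apply: (inj_eq0 ii); rewrite linearZ -uE; exact: (subinclP v).
  by exists u1; apply: tI; rewrite i'E u1E.
- exact: rel_inj_tors.
apply: IH => // y; have [e0 <-] := qs y.
by have [z ->] := rel_inj_divisible Ei e0; exists (q z); rewrite linearZ.
Qed.

End ChangeOfRings.

(** Injectivity of F splits j, so Y is a direct summand of T; the section s is induced by id - j
    r. *)
Lemma rel_inj_quotient J F T Y (j : {linear F -> T}) (p : {linear T -> Y}) :
  rel_inj J F -> rel_inj J T -> injective j -> (forall y, exists t, p t = y) ->
  is_exact j p -> rel_inj J Y.
Proof.
move=> [JF Finj] [JT Tinj] ji ps ex.
have [r rE] := Finj _ _ j [the {linear _ -> _} of idfun] JT ji.
have [t /ex[f ->]|s sE] := @lift_surj _ _ _ _ p [the {linear _ -> _} of idfun \- (j \o r)] ps.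
  by rewrite /= rE subrr.
have psE y : p (s y) = y.
  have [t <-] := ps y; rewrite sE /= linearB.
  have -> : p (j (r t)) = 0 by apply/ex; exists (r t).
  exact: subr0.
split=> [a aJ y _|U V i f JV ii].
  by rewrite -(psE y) /= -linearZ /= (killed JT aJ) linear0.
have [g gE] := Tinj _ _ i [the {linear _ -> _} of s \o f] JV ii.
by exists [the {linear _ -> _} of p \o g] => u /=; rewrite gE /= psE.
Qed.

(** Embed T in an injective E with cokernel Z. Then Y = T/F embeds in E/F with the same cokernel,
    and E/F is injective by the previous lemma. *)
Lemma rel_inj_dim_quotient J (n : nat) F T Y (j : {linear F -> T}) (p : {linear T -> Y}) :
  rel_inj J F -> rel_inj_dim J n T -> injective j -> (forall y, exists t, p t = y) ->
  is_exact j p -> rel_inj_dim J n Y.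
Proof.
case: n => [|n] Fi; first exact: rel_inj_quotient.
move=> [E [Z [i [q [ii qs exi Ei Zi]]]]] ji ps ex.
pose h := [the {linear F -> E} of i \o j].
pose I := image_submodule h; pose Y' : lmodType R := quotient_module I.
pose c : {linear E -> Y'} := qpi I.
have cs := @qpi_surj _ _ _ I : forall y, exists u, c u = y.
have c0 u : c u = 0 <-> exists f, u = h f by exact: qpi_eq0.
have hi : injective h by move=> u v /ii/ji.
have [||i' i'E] := @lift_surj _ _ _ _ p [the {linear _ -> _} of c \o i] => //.
  by move=> t /ex[f ->] /=; apply/c0; exists f.
have [||q' q'E] := @lift_surj _ _ _ _ c q => //.
  by move=> t /c0[f ->] /=; apply/exi; exists (j f).
exists Y', Z, i', q'; split.
- apply: linear_inj => y; have [t <-] := ps y.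
  rewrite i'E => /c0[f /ii ->]; apply/ex; by exists f.
- by move=> y; have [e0 <-] := qs y; exists (c e0).
- move=> y; have [e0 <-] := cs y; rewrite q'E; split.
    by move=> /exi[t ->]; exists (p t); rewrite i'E.
  move=> [u]; have [t <-] := ps u; rewrite i'E /= => E0.
  have /c0[f fE] : c (e0 - i t) = 0 by rewrite linearB E0 subrr.
  rewrite -(subrK (i t) e0) fE linearD.
  have -> : q (i t) = 0 by apply/exi; exists t.
  by rewrite addr0; apply/exi; exists (j f).
- apply: rel_inj_quotient Fi Ei hi cs _.
  exact: c0.
- by [].
Qed.

(** Injective dimension drops by one: since M has no x-torsion and E = xE, the snake lemma for
    multiplication by x gives 0 -> tors E -> tors Q -> M/xM -> 0. *)
Lemma rel_inj_dim_quot1 N (e : N) x n M : cyclic e -> nzd N x -> nzd M x ->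
  rel_inj_dim (annihilator N) n.+1 M ->
  rel_inj_dim (annihilator (quot1 N x)) n (quot1 M x).
Proof.
move=> eN xN xM [E [Q [i [q [ii qs ex Ei Qi]]]]].
have Ediv := rel_inj_divisible eN xN Ei.
have tI U : injective (subincl (torsP x U)) by exact: subincl_inj.
have [j jE] := tors_map x q.
have Ti : rel_inj_dim (annihilator (quot1 N x)) n (tors x Q).
  apply: (rel_inj_dim_tors eN) => // y; have [e0 <-] := qs y.
  by have [z ->] := Ediv e0; exists (q z); rewrite linearZ.
(* the connecting map [tors x Q -> M / xM] of the snake lemma *)
pose D := [set e0 : E | exists u, x *: e0 = i u].
have hD : is_submodule D.
  apply/is_submoduleP; split; first by exists 0; rewrite scaler0 linear0.
  move=> a e1 e2 [u1 E1] [u2 E2]; exists (a *: u1 + u2).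
  by rewrite (linearP i) -E1 -E2 scalerDr !scalerA mulrC.
have [|qD qDE] := @subcorestr _ _ _ _ (torsP x Q) [the {linear _ -> _} of q \o subincl hD].
  move=> d /=; rewrite -linearZ; have [u ->] := subinclP d.
  by apply/ex; exists u.
have /choice[g gE] : forall d : submodule hD, exists u, x *: subincl hD d = i u.
  by move=> d; exact: (subinclP d).
have gl : linear (fun d => pi1 M x (g d)).
  move=> a u v /=; rewrite -linearP; congr (pi1 M x _); apply: ii.
  rewrite -gE (linearP (subincl hD)) (linearP i) -!gE scalerDr !scalerA.
  by rewrite mulrC.
have qDs y : exists d, qD d = y.
  have [e0 e0E] := qs (subincl (torsP x Q) y).
  have /ex[u uE] : q (x *: e0) = 0 by rewrite linearZ e0E; exact: (subinclP y).
  have [|d dE] := subincl_surj hD (u := e0); first by exists u.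
  by exists d; apply: tI; rewrite qDE /= dE.
have [|d dq|p pE] := @lift_surj _ _ _ _ qD (mklin gl) => //.
  have /ex[u uE] : q (subincl hD d) = 0 by have := qDE d; rewrite dq linear0.
  rewrite mklinE; apply/pi1_eq0; exists u; apply: ii.
  by rewrite -gE linearZ uE.
have {}pE d u : x *: subincl hD d = i u -> p (qD d) = pi1 M x u.
  by move=> du; rewrite pE mklinE; congr (pi1 M x _); apply: ii; rewrite -gE.
apply: (rel_inj_dim_quotient (j := j) (p := p)) => //.
- exact: rel_inj_tors eN _ _ Ei.
- apply: linear_inj => t jt; apply: tI; rewrite linear0.
  have /ex[u uE] : q (subincl (torsP x E) t) = 0 by rewrite -jE jt linear0.
  rewrite uE; suff -> : u = 0 by rewrite linear0.
  by apply/xM/(inj_eq0 ii); rewrite linearZ -uE; exact: (subinclP t).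
- move=> y; have [u <-] := pi1_surj y; have [e0 e0E] := Ediv (i u).
  have [|d dE] := subincl_surj hD (u := e0); first by exists u.
  by exists (qD d); apply: pE; rewrite dE.
move=> y; split=> [|[t ->]]; last first.
  have [|d dE] := subincl_surj hD (u := subincl (torsP x E) t).
    by exists 0; rewrite linear0; exact: (subinclP t).
  have -> : j t = qD d by apply: tI; rewrite jE qDE /= dE.
  rewrite (pE d 0) ?linear0 // dE; exact: (subinclP t).
have [d <-] := qDs y; have [u uE] := subinclP d; rewrite (pE d u) //.
move=> /pi1_eq0[v vE].
have [|t tE] := subincl_surj (torsP x E) (u := subincl hD d - i v).
  by rewrite /= scalerBr uE vE linearZ subrr.
exists t; apply: tI; rewrite jE tE qDE /= linearB.
have -> : q (i v) = 0 by apply/ex; exists v.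
by rewrite subr0.
Qed.

Lemma rel_inj_dim_quot_seq N (e : N) xs n M : cyclic e -> weak_regular N xs -> weak_regular M xs ->
  rel_inj_dim (annihilator N) n M ->
  exists n', rel_inj_dim (annihilator (quot_seq N xs)) n' (quot_seq M xs).
Proof.
elim: xs N e M n => [|x xs IH] N e M n eN /=; first by exists n.
(* The bound is first raised by one, so that each quotient step hands back the same n. *)
move=> [xN wN] [xM wM] /rel_inj_dimS Mi.
exact: IH (cyclic_quot1 eN) wN wM (rel_inj_dim_quot1 eN xN xM Mi).
Qed.

Lemma rel_inj_socle_ext (m : set R) J W E (w : W) (y : E) : local_max m ->
  J `<=` annihilator W -> rel_inj J E ->
  w <> 0 -> socle m W w -> socle m E y -> exists g : {linear W -> E}, g w = y.
Proof.
move=> lm JW [JE Einj] w0 ws ys; have [mm mu] := lm.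
have [i iE] := residue_map mm ws; have [f fE] := residue_map mm ys.
have ii : injective i.
  apply: linear_inj => z; have [r <-] := qpi_surj z; rewrite iE => rw.
  apply/qpi_eq0; apply: contrapT => /mu[b br].
  by apply: w0; rewrite -[w]scale1r -br -scalerA rw scaler0.
have [g gE] := Einj _ _ i f JW ii; exists g.
by have := gE (qpi (maximal_ideal mm) (1 : R^o)); rewrite iE fE !scale1r.
Qed.

(** * Finite injective dimension over the Artinian quotient *)

Section Artinian.
Variables (m : set R) (lm : local_max m) (N : lmodType R) (e : N) (eN : cyclic e).
Local Notation J := (annihilator N).
Hypothesis ess : forall (W : lmodType R) (w : W), J `<=` annihilator W -> w <> 0 ->
  exists2 r, r *: w <> 0 & socle m W (r *: w).

(* A partial map to Z with maximal domain D is total: otherwise some v1 outside D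
   satisfies m v1 <= D, and the map extends to v1 because R / m embeds in R / J. *)
Lemma rel_inj_kernel Z E Q (i : {linear Z -> E}) (q : {linear E -> Q}) :
  e <> 0 -> injective i -> (forall y, exists u, q u = y) -> is_exact i q ->
  rel_inj J E -> rel_inj J Q -> rel_inj J Z.
Proof.
move=> e0 ii qs ex Ei Qi; have [JE Einj] := Ei; have [mm mu] := lm.
split=> [a aJ z _|U V k f JV ki].
  by apply: (inj_eq0 ii); rewrite linearZ /= (killed JE aJ).
(* Pick r with r e a nonzero socle element of N. Injectivity of Q gives g with g (r e) = y; for a
   lift u of g e to E, the element r u lifts y, and m kills it because m r lies in J. *)
have lift_socle y : socle m Q y -> exists2 u, socle m E u & q u = y.
  move=> ys; have [r re rs] := @ess N e (fun _ h => h) e0.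
  have [g gE] := rel_inj_socle_ext lm (fun _ h => h) Qi re rs ys.
  have [u uE] := qs (g e); exists (r *: u); last by rewrite linearZ uE -linearZ.
  move=> a ma; rewrite scalerA; apply: (JE (a * r)) => //.
  by apply/(cyclic_ann _ eN); rewrite -scalerA; exact: rs.
(* Partial extensions of f are handled through their graphs, ordered by inclusion. *)
pose good (G : set (V * Z)) := [/\ is_submodule G, forall z, G (0, z) -> z = 0 &
  forall u, G (k u, f u)].
have G0 : good [set c | exists u, c = (k u, f u)].
  split; last by move=> u; exists u.
    apply/is_submoduleP; split; first by exists 0; rewrite !linear0.
    by move=> a _ _ [u ->] [v ->]; exists (a *: u + v); rewrite !linearP.
  by move=> z [u [ku ->]]; rewrite (@inj_eq0 _ _ k u) ?linear0.
have [A [PA Amax]] : exists A, (A = set0 \/ good A) /\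
    forall B, A `<` B -> ~ (B = set0 \/ good B).
  apply: (@Zorn_bigcup _ [set A | A = set0 \/ good A]) => F FP Ftot.
  have [[A [FA gA]]|noA] := pselect (exists A, F A /\ good A); last first.
    left; apply/seteqP; split=> // a [B FB Ba].
    by case: (FP _ FB) => [B0|PB]; [rewrite B0 in Ba|case: noA; exists B].
  right; split.
  - apply/is_submoduleP; split; first by exists A => //; apply: smod0; case: gA.
    move=> a u v [B FB Bu] [C FC Cv].
    have hB : is_submodule B by case: (FP _ FB) => [E0|[]//]; rewrite E0 in Bu.
    have hC : is_submodule C by case: (FP _ FC) => [E0|[]//]; rewrite E0 in Cv.
    have [BC|CB] := Ftot _ _ FB FC.
      by exists C => //; apply: smodL => //; exact: BC.
    by exists B => //; apply: smodL => //; exact: CB.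
  - move=> z [B FB Bz]; case: (FP _ FB) => [E0|[_ + _]]; last exact.
    by rewrite E0 in Bz.
  - by move=> u; exists A => //; case: gA.
have {PA}[hA A0 Af] : good A.
  case: PA => // A0; case: (Amax [set c | exists u, c = (k u, f u)]); last by right.
  rewrite A0 properEneq; split=> //; apply/eqP => E0.
  by have : set0 (k 0, f 0) by rewrite E0; exists 0.
have Auniq v z z' : A (v, z) -> A (v, z') -> z = z'.
  move=> Az Az'; apply/eqP; rewrite -subr_eq0; apply/eqP/A0.
  have := smodB hA Az Az'; congr A.
  by apply: injective_projections => /=; rewrite ?subrr.
pose D := [set v | exists z, A (v, z)].
have hD : is_submodule D.
  apply/is_submoduleP; split; first by exists 0; exact: (smod0 hA).
  by move=> a u v [z Az] [z' Az']; exists (a *: z + z'); exact: (smodL a hA Az Az').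
suff DT : forall v, D v.
  have [g gE] := choice DT.
  have gl : linear g.
    move=> a u v; apply: (Auniq (a *: u + v)) => //.
    exact: (smodL a hA (gE u) (gE v)).
  by exists (mklin gl) => u; rewrite mklinE; exact: Auniq (gE _) (Af u).
move=> v0; apply: contrapT => Dv0.
have [||r rv0 rs] := @ess (quotient_module hD) (qpi hD v0).
- move=> a aJ y _; have [u <-] := qpi_surj y.
  by rewrite /= -linearZ /= (killed JV aJ) linear0.
- by move=> /qpi_eq0.
pose v1 := r *: v0.
have Dv1 : ~ D v1 by move=> Dv1; apply: rv0; rewrite -linearZ; apply/qpi_eq0.
have mv1 a : m a -> D (a *: v1).
  by move=> ma; apply/(qpi_eq0 hD); rewrite !linearZ; exact: rs.
move: Dv1 mv1; clearbody v1 => Dv1 mv1.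
have /choice[g gE] : forall d : submodule hD, exists z, A (subincl hD d, z).
  by move=> d; exact: (subinclP d).
have gl : linear g.
  move=> a u v; apply: (Auniq (subincl hD (a *: u + v))) => //.
  by rewrite linearP; exact: (smodL a hA (gE u) (gE v)).
have [h hE] := Einj _ _ (subincl hD) [the {linear _ -> _} of i \o mklin gl] JV
  (@subincl_inj _ _ _ hD).
have {}hE v z : A (v, z) -> h v = i z.
  move=> Az; have [|d dE] := subincl_surj hD (u := v); first by exists z.
  rewrite -dE hE /= mklinE; congr (i _); apply: Auniq (gE d) _.
  by rewrite dE.
(* On D the map h comes from Z, so q h vanishes on m v1 and q (h v1) is in the socle. Subtracting a
   socle lift u moves h v1 into the image of Z without changing anything on m v1. *)
have [|u us uE] := lift_socle (q (h v1)).
  move=> a /mv1[z /hE az]; have -> : a *: q (h v1) = q (h (a *: v1)) by rewrite !linearZ.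
  by rewrite az; apply/ex; exists z.
have /ex[z zE] : q (h v1 - u) = 0 by rewrite linearB uE subrr.
pose B := [set c : V * Z | exists a c', A c' /\ c = c' + a *: (v1, z)].
have Bv1 : B (v1, z).
  by exists 1, 0; split; [exact: smod0|rewrite add0r scale1r].
have AB : A `<=` B by move=> c Ac; exists 0, c; split; [exact: Ac|rewrite scale0r addr0].
apply: (Amax B); last right.
  rewrite properEneq; split=> //; apply/eqP => E0; apply: Dv1.
  by exists z; rewrite E0.
split; last by move=> w; exact/AB/Af.
  apply/is_submoduleP; split; first exact: (AB _ (smod0 hA)).
  move=> a _ _ [b [c [Ac ->]]] [b' [c' [Ac' ->]]].
  exists (a * b + b'), (a *: c + c'); split; first exact: smodL.
  by rewrite scalerDr scalerDl addrACA scalerA.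
move=> y [a [[w z'] [Awz [E1 E2]]]].
have wE : w = - (a *: v1) by apply/eqP; rewrite -addr_eq0 -E1.
(* The enlarged graph is still single-valued: a must lie in m, as otherwise v1 would be in D, and
   then a kills the correction u. *)
have ma : m a.
  apply: contrapT => /mu[b ba]; apply: Dv1.
  have := smodZ (- b) hD (ex_intro _ z' Awz : D w).
  by rewrite wE scalerN scaleNr opprK scalerA ba scale1r.
rewrite E2; apply: (inj_eq0 ii).
rewrite linearD linearZ /= -zE scalerBr us // subr0 -(hE _ _ Awz) wE linearN [h (a *: _)]linearZ /=.
exact: addNr.
Qed.

Lemma rel_inj_dim_inj n M : e <> 0 -> rel_inj_dim J n M -> rel_inj J M.
Proof.
move=> e0; elim: n M => [|n IH] M //= [E [Q [i [q [ii qs ex Ei /IH Qi]]]]].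
exact: rel_inj_kernel ii qs ex Ei Qi.
Qed.

End Artinian.
End RelativeInjective.

(** * Lifting maps modulo a regular sequence *)

Section RegularSequences.
Variables (R : comPzRingType) (M : lmodType R) (x : R).

(** This turns the condition of [regular_seq] at index i + 1 on M into its condition at index i on
    M/xM. *)
Lemma seq_smul_quot1 ys (u : M) :
  @seq_smul _ (quot1 M x) ys (pi1 M x u) <-> @seq_smul _ M (x :: ys) u.
Proof.
have sI (xs : seq R) : is_ideal (@span R R^o [set` xs]) by exact: spanP.
have sM (L : lmodType R) xs : is_submodule (@seq_smul _ L xs).
  by apply: smulP; exact: spanP.
split; last first.
  apply: (@smul_least _ _ _ _ [set u | @seq_smul _ (quot1 M x) ys (pi1 M x u)]).
    apply/is_submoduleP; split; first by rewrite /= linear0; exact: smod0.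
    by move=> a v w /= hv hw; rewrite linearP; exact: smodL.
  move=> a v /(@span_consP _ R^o)[r [b [bs ->]]] _ /=.
  rewrite linearZ /=; have -> : (r *: (x : R^o) + b : R) *: pi1 M x v = b *: pi1 M x v.
    by rewrite [LHS](scalerDl _ (r * x) (b : R)) -scalerA quot1x scaler0 add0r.
  exact: smul_gen.
move=> hu; suff [w [ws /pi1_eq[v ->]]] :
    exists w, @seq_smul _ M (x :: ys) w /\ pi1 M x u = pi1 M x w.
  apply: smodD => //; apply: smul_gen => //; apply: (@spanS _ R^o).
  by rewrite /= inE eqxx.
move: hu; apply: (@smul_least _ _ _ _ [set y | exists w,
    @seq_smul _ M (x :: ys) w /\ y = pi1 M x w]).
  apply/is_submoduleP; split; first by exists 0; rewrite linear0; split=> //; exact: smod0.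
  move=> a _ _ [v [hv ->]] [w [hw ->]]; exists (a *: v + w).
  by rewrite linearP; split=> //; exact: smodL.
move=> a y ays _; have [v <-] := pi1_surj y; exists (a *: v); rewrite linearZ.
split=> //; apply: smul_gen => //.
by apply: (@span_sub _ R^o) ays => z zs; rewrite inE zs orbT.
Qed.

End RegularSequences.

Lemma regular_seq_weak_regular (R : comPzRingType) (M : lmodType R) (xs : seq R) :
  regular_seq M xs -> weak_regular M xs.
Proof.
move=> [_]; elim: xs M => [|x xs IH] M //= H; split.
  have smul0 (u : M) : @seq_smul _ M [::] u <-> u = 0.
    split=> [|->]; last by apply: smod0; apply: smulP; exact: spanP.
    apply: (@smul_least _ _ _ _ [set 0] (smod_set0 M)) => a v /(@span_nilE _ R^o) -> _ /=.
    exact: scale0r.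
  by move=> u xu; have := H 0%N u isT; rewrite /= xu !smul0; exact.
apply: IH => i y lt_i; have [u <-] := pi1_surj y.
rewrite -linearZ !seq_smul_quot1; exact: (H i.+1 u lt_i).
Qed.

Lemma annihilator_quot_seq (R : comPzRingType) (M : lmodType R) xs :
  annihilator M `<=` annihilator (quot_seq M xs).
Proof.
elim: xs M => [|x xs IH] M //=.
by apply: subset_trans (IH _); exact: annihilator_quot1.
Qed.

Lemma quot_seq_killed (R : comPzRingType) (M : lmodType R) xs x (y : quot_seq M xs) :
  x \in xs -> x *: y = 0.
Proof.
elim: xs M y => [|z xs IH] M //= y; rewrite inE => /orP[/eqP->|]; last exact: IH.
apply: (killed (@annihilator_quot_seq _ (quot1 M z) xs)) => v _; exact: quot1x.
Qed.

Lemma cyclic_quot_seq (R : comPzRingType) (N : lmodType R) (e : N) xs :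
  cyclic e -> cyclic (pi_seq N xs e).
Proof. by elim: xs N e => [|x xs IH] N e eN //=; apply: IH; exact: cyclic_quot1. Qed.

Lemma annihilator_cyclic_quot_seq (R : comPzRingType) (N M : lmodType R) (e : N) xs :
  cyclic e -> annihilator N `<=` annihilator M ->
  annihilator (quot_seq N xs) `<=` annihilator (quot_seq M xs).
Proof.
elim: xs N M e => [|x xs IH] N M e eN //= NM; apply: (IH _ _ (pi1 N x e)).
  exact: cyclic_quot1.
move=> a aN y _; have [u <-] := pi1_surj y.
have /pi1_eq0[v vE] : pi1 N x (a *: e) = 0 by rewrite linearZ; exact: (aN _ I).
have [s sE] := eN v.
have /NM aM : annihilator N (a - x * s).
  by apply/(cyclic_ann _ eN); rewrite scalerBl vE sE scalerA subrr.
rewrite /= -linearZ; apply/pi1_eq0; exists (s *: u).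
by apply/eqP; rewrite scalerA -subr_eq0 -scalerBl; apply/eqP/aM.
Qed.

Lemma quot_seq_nontrivial (R : comPzRingType) (m : set R) (M : lmodType R) xs :
  local_max m -> fin_gen M -> (forall x, x \in xs -> m x) ->
  trivial_module (quot_seq M xs) -> trivial_module M.
Proof.
move=> lm Mfg xm W0; apply: (nakayama_fg lm Mfg (smod_set0 M)) => u.
exists 0, u; rewrite add0r; split=> //.
by apply: (pi_seq_eq0 _ xm); [case: lm => -[]|exact: W0].
Qed.

Section SimpleSocle.
Variables (R : comPzRingType) (m : set R) (lm : local_max m).

Definition socle_le1 (W : lmodType R) : Prop :=
  forall u v, socle m W u -> socle m W v ->
  exists a b, ~ (m a /\ m b) /\ a *: u + b *: v = 0.

Lemma scale_unit_eq0 (W : lmodType R) a (u : W) : ~ m a -> a *: u = 0 -> u = 0.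
Proof.
have [_ mu] := lm; move=> /mu[b ba] au.
by rewrite -[u]scale1r -ba -scalerA au scaler0.
Qed.

(** A nonzero kernel would meet the socle, which is the R/m-line through u, and g does not vanish
    there. *)
Lemma socle_inj (W V : lmodType R) (g : {linear W -> V}) (u : W) :
  (forall w : W, w <> 0 -> exists2 r, r *: w <> 0 & socle m W (r *: w)) ->
  socle_le1 W -> socle m W u -> g u <> 0 -> injective g.
Proof.
move=> ess W1 us gu; apply: linear_inj => w gw; apply: contrapT => w0.
have [r rw0 rws] := ess w w0; have [a [b [ab E]]] := W1 _ _ us rws.
have ga : a *: g u = 0.
  have : g (a *: u + b *: (r *: w)) = 0 by rewrite E linear0.
  by rewrite linearD !linearZ gw /= !scaler0 addr0.
have [ma|ma] := pselect (m a); last by apply: gu; exact: scale_unit_eq0 ma ga.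
have mb : ~ m b by move=> mb; apply: ab.
by apply: rw0; apply: (scale_unit_eq0 mb); rewrite us // add0r in E.
Qed.

(** A map g matching the two socles is injective, hence has a retraction p. On the simple socle of
    W2 the map p is nonzero too, so p is injective, and p g p = p makes g surjective. *)
Lemma rel_inj_socle_surj J (W1 W2 : lmodType R) :
  (forall (W : lmodType R) (w : W), J `<=` annihilator W -> w <> 0 ->
    exists2 r, r *: w <> 0 & socle m W (r *: w)) ->
  rel_inj J W1 -> rel_inj J W2 -> socle_le1 W1 -> socle_le1 W2 ->
  ~ trivial_module W1 -> exists g : {linear W1 -> W2}, forall y, exists u, g u = y.
Proof.
move=> ess I1 I2 s1 s2 nt1.
have [[w2 w20]|all0] := pselect (exists w : W2, w <> 0); last first.
  exists [the {linear _ -> _} of \0] => y; exists 0 => /=.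
  by apply: contrapT => y0; apply: all0; exists y => E; apply: y0.
have [[w1 w10]|all0] := pselect (exists w : W1, w <> 0); last first.
  by case: nt1 => u; apply: contrapT => u0; apply: all0; exists u.
have [J1 _] := I1; have [J2 _] := I2.
have [r1 r10 r1s] := ess _ _ J1 w10; have [r2 r20 r2s] := ess _ _ J2 w20.
have [g gE] := rel_inj_socle_ext lm J1 I2 r10 r1s r2s.
have ginj : injective g.
  by apply: socle_inj s1 r1s _ => [w|]; [exact: ess|rewrite gE].
have [_ ext1] := I1.
have [p pE] := ext1 _ _ g [the {linear _ -> _} of idfun] J2 ginj.
have pinj : injective p.
  apply: socle_inj s2 r2s _ => [w|]; first exact: ess.
  by rewrite -gE pE.
exists g => y; exists (p y); apply: pinj; exact: pE.
Qed.

End SimpleSocle.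

(** * Finite free modules and presentations *)

Section FreeModules.
Variables (R : comPzRingType) (n : nat).
Local Notation F := {ffun 'I_n -> R^o}.

Definition delta (M : lmodType R) (i : 'I_n) (u : M) : {ffun 'I_n -> M} :=
  [ffun j => if j == i then u else 0].

Lemma delta_linear (M : lmodType R) i : linear (@delta M i).
Proof.
by move=> a u v; apply/ffunP => j; rewrite !ffunE; case: eqP; rewrite ?scaler0 ?addr0.
Qed.

Lemma sum_delta (M : lmodType R) (f : {ffun 'I_n -> M}) : f = \sum_i delta i (f i).
Proof.
apply/ffunP => j; rewrite sum_ffunE (bigD1 j) //= ffunE eqxx big1 ?addr0 //.
by move=> i ij; rewrite ffunE eq_sym (negbTE ij).
Qed.

Lemma fin_gen_ffun (M : lmodType R) : fin_gen M -> fin_gen {ffun 'I_n -> M}.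
Proof.
move=> [s sT]; exists [seq delta i u | i <- enum 'I_n, u <- s].
apply/seteqP; split=> // f _; rewrite (sum_delta f); set S := span _.
apply: smod_sum => [|i _]; first exact: spanP.
have : span [set` s] (f i) by rewrite sT.
rewrite -(mklinE (@delta_linear M i)).
apply: (@span_least _ _ _ [set u | S (mklin (@delta_linear M i) u)]).
  apply/is_submoduleP; split; first by rewrite /= linear0; apply: smod0; exact: spanP.
  by move=> a u v /= hu hv; rewrite linearP; apply: smodL => //; exact: spanP.
move=> u /= us; rewrite mklinE; apply: spanS; apply/allpairsP; exists (i, u).
by rewrite mem_enum.
Qed.

Lemma free_map (M : lmodType R) (c : 'I_n -> M) :
  exists f : {linear F -> M}, forall a, f a = \sum_i (a i : R) *: c i.
Proof.
have fl : linear (fun a : F => \sum_i (a i : R) *: c i).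
  move=> r a b; rewrite scaler_sumr -big_split; apply: eq_bigr => i _ /=.
  by rewrite !ffunE scalerDl scalerA.
by exists (mklin fl) => a; rewrite mklinE.
Qed.

Lemma free_projective : projective_module F.
Proof.
move=> U V q f /choice[s sE].
pose d i : F := @delta R^o i (1 : R).
have [g gE] := free_map (fun i => s (f (d i))).
exists g => a; rewrite gE linear_sum {2}(sum_delta a) linear_sum.
apply: eq_bigr => i _; rewrite linearZ sE -linearZ; congr (f _).
by apply/ffunP => j; rewrite !ffunE; case: eqP; rewrite ?scaler0 // /GRing.scale/= mulr1.
Qed.

End FreeModules.

Lemma free_presentation (R : comPzRingType) (M : lmodType R) : fin_gen M ->
  exists (F : lmodType R) (q : {linear F -> M}),
    [/\ fin_gen F, projective_module F & forall u, exists f, q f = u].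
Proof.
move=> [s sT]; have [q qE] := free_map (fun i : 'I_(size s) => s`_i).
exists {ffun 'I_(size s) -> R^o}, q; split.
- apply: fin_gen_ffun; exists [:: (1 : R^o)]; apply/seteqP; split=> // r _.
  have -> : r = (r : R) *: (1 : R^o) by rewrite /GRing.scale/= mulr1.
  by apply: smodZ; [exact: spanP|apply: spanS; rewrite /= inE].
- exact: free_projective.
move=> u; have : span [set` s] u by rewrite sT.
move=> /(span_least (image_submodule q)); case=> [v /= vs|f ->]; last by exists f.
have vi : (index v s < size s)%N by rewrite index_mem.
exists (@delta R _ R^o (Ordinal vi) (1 : R)); rewrite qE (bigD1 (Ordinal vi)) //=.
rewrite ffunE eqxx scale1r nth_index // big1 ?addr0 // => i ij.
by rewrite ffunE (negbTE ij) scale0r.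
Qed.

Section Extension.
Variables (R : comPzRingType) (Rn : noetherian R) (m : set R) (lm : local_max m).
Implicit Types K F N M W U V : lmodType R.

Lemma quot1_map U V x (f : {linear U -> V}) :
  exists g : {linear quot1 U x -> quot1 V x}, forall u, g (pi1 U x u) = pi1 V x (f u).
Proof.
have [||g gE] := @lift_surj _ _ _ _ (pi1 U x) [the {linear _ -> _} of pi1 V x \o f].
- exact: pi1_surj.
- by move=> u /pi1_eq0[v ->] /=; rewrite linearZ pi1x.
by exists g.
Qed.

(* K / (xs) K -> F / (xs) F stays injective because xs is regular on F / K *)
Lemma extend_rel_inj J W xs K F N (i : {linear K -> F}) (q : {linear F -> N}) :
  rel_inj J W -> (forall x w, x \in xs -> x *: w = 0 :> W) ->
  injective i -> (forall y, exists u, q u = y) -> is_exact i q ->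
  weak_regular N xs -> J `<=` annihilator (quot_seq F xs) ->
  forall h : {linear K -> W}, exists g : {linear F -> W}, forall k, g (i k) = h k.
Proof.
move=> [JW Winj]; elim: xs K F N i q => [|x xs IH] K F N i q xW ii qs ex /=.
  by move=> _ JF h; exact: Winj.
move=> [xN wN] JF h.
have [i' i'E] := quot1_map x i; have [q' q'E] := quot1_map x q.
have [||h' h'E] := @lift_surj _ _ _ _ (pi1 K x) h.
- exact: pi1_surj.
- by move=> u /pi1_eq0[v ->]; rewrite linearZ; apply: xW; exact: mem_head.
have [||||g gE] := IH _ _ _ i' q' _ _ _ _ wN JF h'.
- by move=> y w ys; apply: xW; rewrite inE ys orbT.
- apply: linear_inj => y; have [k <-] := pi1_surj y; rewrite i'E => /pi1_eq0[f fE].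
  have /ex[k' k'E] : q f = 0.
    by apply: xN; rewrite -linearZ -fE; apply/ex; exists k.
  by apply/pi1_eq0; exists k'; apply: ii; rewrite fE k'E linearZ.
- move=> y; have [u <-] := pi1_surj y; have [f <-] := qs u.
  by exists (pi1 F x f).
- move=> y; split=> [|[k ->]]; last first.
    have [k' <-] := pi1_surj k; rewrite i'E q'E.
    have -> : q (i k') = 0 by apply/ex; exists k'.
    exact: linear0.
  have [f <-] := pi1_surj y; rewrite q'E => /pi1_eq0[v vE].
  have [f' f'E] := qs v.
  have /ex[k kE] : q (f - x *: f') = 0 by rewrite linearB linearZ f'E vE subrr.
  exists (pi1 K x k); rewrite i'E -kE linearB.
  by rewrite (pi1x x f') subr0.
exists [the {linear _ -> _} of g \o pi1 F x] => k /=.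
by rewrite -i'E gE h'E.
Qed.

Variables (K F N : lmodType R) (i : {linear K -> F}) (q : {linear F -> N}).
Hypotheses (Kfg : fin_gen K) (Fproj : projective_module F).
Hypotheses (ii : injective i) (qs : forall y, exists u, q u = y) (ex : is_exact i q).

(** As F is projective, this says Ext^1(N, M) = 0. *)
Definition extends M : Prop :=
  forall h : {linear K -> M}, exists g : {linear F -> M}, forall k, g (i k) = h k.

(* Nakayama's lemma applied to the cokernel of Hom(F, M) -> Hom(K, M) *)
Lemma extends_quot1 M x : fin_gen M -> m x -> nzd M x -> extends (quot1 M x) -> extends M.
Proof.
move=> Mfg mx xM ext h; have [s sT] := Kfg.
(* Maps are recorded by their values at generators of K, which realizes Hom(K, M) as a submodule of
   a finite power of M and hence makes it finitely generated. *)
pose ev (f : K -> M) : {ffun 'I_(size s) -> M} := [ffun j : 'I_(size s) => f s`_j].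
pose H := [set v | exists f : {linear K -> M}, v = ev f].
pose G := [set v | exists g : {linear F -> M}, v = ev (g \o i)].
have hH : is_submodule H.
  apply/is_submoduleP; split.
    by exists [the {linear _ -> _} of \0]; apply/ffunP => j; rewrite !ffunE.
  move=> a _ _ [f ->] [g ->].
  have fl : linear (fun k => a *: f k + g k).
    move=> r u v /=; rewrite (linearP f) (linearP g) !scalerDr !scalerA mulrC.
    by rewrite addrACA.
  by exists (mklin fl); apply/ffunP => j; rewrite !ffunE mklinE.
have hG : is_submodule G.
  apply/is_submoduleP; split.
    by exists [the {linear _ -> _} of \0]; apply/ffunP => j; rewrite !ffunE.
  move=> a _ _ [f ->] [g ->].
  have fl : linear (fun k => a *: f k + g k).
    move=> r u v /=; rewrite (linearP f) (linearP g) !scalerDr !scalerA mulrC.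
    by rewrite addrACA.
  by exists (mklin fl); apply/ffunP => j; rewrite !ffunE /= mklinE.
have [t tE] := noeth_fin_gen Rn (fin_gen_ffun (size s) Mfg) hH.
have [g gE] : G (ev h).
  apply: (nakayama lm hG (s := t)); last by rewrite -tE; exists h.
  move=> v vt; have [f ->] : H v by rewrite tE; exact: spanS.
  (* Modulo x the map f extends to F, and projectivity lifts the extension to g with values in M; so
     f - g i = x f' lies in m Hom(K, M). *)
  have [g0 g0E] := ext [the {linear _ -> _} of pi1 M x \o f].
  have [g gE] := Fproj g0 (@pi1_surj _ M x).
  have fl : linear (fun k => f k - g (i k)).
    by move=> a u w /=; rewrite !linearP /= scalerDr addrACA.
  have [k|f' f'E] := divide_nzd xM fl.
    by apply/pi1_eq0; rewrite linearB gE g0E subrr.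
  exists (ev (g \o i)), (x *: ev f'); split.
  - by exists g.
  - by apply: smul_gen => //; rewrite -tE; exists f'.
  by apply/ffunP => j; rewrite !ffunE /= -f'E addrC subrK.
exists g => k; have : span [set` s] k by rewrite sT.
have eqP : is_submodule [set k | g (i k) = h k].
  apply/is_submoduleP; split; first by rewrite /= !linear0.
  by move=> a u v /= gu gv; rewrite !linearP gu gv.
apply: (span_least eqP) => u /= us.
have ui : (index u s < size s)%N by rewrite index_mem.
have := congr1 (fun v : {ffun _ -> _} => v (Ordinal ui)) gE.
by rewrite !ffunE /= nth_index.
Qed.

Lemma extends_quot_seq M xs : fin_gen M -> (forall x, x \in xs -> m x) -> weak_regular M xs ->
  extends (quot_seq M xs) -> extends M.
Proof.
elim: xs M => [|x xs IH] M Mfg xm //= [xM wM] E.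
apply: (@extends_quot1 M x) => //; first by apply: xm; exact: mem_head.
apply: IH => //; first exact: fin_gen_quot1.
by move=> y ys; apply: xm; rewrite inE ys orbT.
Qed.

(** One step lifts g1 : N -> M/xM. A lift g2 of g1 q to F restricts on K to x h; extending h to g3
    on F, the map g2 - x g3 vanishes on K and descends to N. *)
Lemma lift_quot_seq M xs : fin_gen M -> (forall x, x \in xs -> m x) -> weak_regular M xs ->
  extends (quot_seq M xs) -> forall f : {linear N -> quot_seq M xs},
  exists g : {linear N -> M}, forall y, pi_seq M xs (g y) = f y.
Proof.
elim: xs M => [|x xs IH] M Mfg xm wM E f /=; first by exists f.
have /= [xM wM'] := wM.
have [|g1 g1E] := IH (quot1 M x) (fin_gen_quot1 x Mfg) _ wM' E f.
  by move=> y ys; apply: xm; rewrite inE ys orbT.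
have [g2 g2E] := Fproj [the {linear _ -> _} of g1 \o q] (@pi1_surj _ M x).
have fl : linear (fun k => g2 (i k)) by move=> a u v /=; rewrite !linearP.
have [k|h hE] := divide_nzd xM fl.
  apply/pi1_eq0; rewrite g2E /=.
  have -> : q (i k) = 0 by apply/ex; exists k.
  exact: linear0.
have [g3 g3E] := extends_quot_seq Mfg xm wM E h.
have gl : linear (fun u => g2 u - x *: g3 u).
  by move=> a u v /=; rewrite !linearP /= scalerDr addrACA.
have [u|g gE] := @lift_surj _ _ _ _ q (mklin gl) qs.
  by move=> /ex[k ->]; rewrite mklinE hE g3E subrr.
exists g => y; have [u <-] := qs y; rewrite gE mklinE -g1E; congr (pi_seq _ _ _).
by rewrite linearB pi1x subr0 g2E.
Qed.

End Extension.

(** * Canonical modules and localization *)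

Section CanonicalLocal.
Variables (R : comPzRingType) (Rn : noetherian R) (m : set R) (lR : local_ring m).
Let lm : local_max m := local_ring_max Rn lR.

Lemma krull_dim_unique (M : lmodType R) d d' :
  has_krull_dim M d -> has_krull_dim M d' -> d = d'.
Proof.
move=> [[p pP] dmax] [[q qP] d'max]; apply/eqP.
by rewrite eqn_leq (d'max _ _ pP) (dmax _ _ qP).
Qed.

Variables (xs : seq R) (xsm : forall x, x \in xs -> m x) (wR : weak_regular R^o xs).
Hypothesis dimR : forall k q, prime_chain R^o k q -> (k <= size xs)%N.
Local Notation J := (annihilator (quot_seq R^o xs)).

Lemma cyclic_regular : cyclic (1 : R^o).
Proof. by move=> u; exists u; rewrite /GRing.scale/= mulr1. Qed.

Lemma essential_socle (W : lmodType R) (w : W) : J `<=` annihilator W -> w <> 0 ->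
  exists2 r, r *: w <> 0 & socle m W (r *: w).
Proof. exact: (socle_multiple Rn lm cyclic_regular wR dimR). Qed.

Lemma rel_inj_reduction (C : lmodType R) : weak_regular C xs -> fin_inj_dim C ->
  rel_inj J (quot_seq C xs).
Proof.
move=> wC /fin_inj_dim_rel[n Cn].
have [n' Cn'] := rel_inj_dim_quot_seq cyclic_regular wR wC Cn.
apply: (rel_inj_dim_inj lm (cyclic_quot_seq (xs := xs) cyclic_regular) essential_socle _ Cn').
(* The class of 1 in R/(xs) is nonzero, as [xs] lies in m. *)
move=> e0; have [[hm m1 _] _] := lm; apply: m1.
have [p [b [c [mb _ ->]]]] := pi_seq_eq0 hm xsm e0.
apply: (@smod_sum _ R^o _ _ _ _ hm) => i _.
exact: (idlMr hm (c i) (mb i)).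
Qed.

Lemma socle_reduction (C : lmodType R) (hm : is_maximal m) : fin_gen C ->
  ~ trivial_module C -> weak_regular C xs -> rel_inj J (quot_seq C xs) -> has_type hm C 1 ->
  socle_le1 m (quot_seq C xs).
Proof.
move=> Cfg Cnt wC [JW _].
move=> [n [ys [ysn /regular_seq_weak_regular wys ysm _]] /ext_residue_dim1[P [P1 Pn]]].
have vxs := ext_vanish_weak_regular (P := P) wC xsm.
suff nE : n = size xs.
  move=> u v us vs; apply: ext_le1_socle us vs.
    by apply: (ext_le1_quot_seq wC vxs); rewrite -nE.
(* A larger n would kill Ext^0(k, C/(xs)C), hence the socle of a nonzero module with essential
   socle; a smaller n would make Ext^n(k, C) vanish, against type one. *)
apply/eqP; rewrite eqn_leq; apply/andP; split; rewrite leqNgt; apply/negP => lt_n.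
  apply: Cnt; apply: (quot_seq_nontrivial lm Cfg xsm) => w; apply: contrapT => w0.
  have [r rw rs] := essential_socle JW w0.
  apply: rw; apply: (ext_vanish0_socle (P := P)) rs.
  apply: (@ext_vanish_quot_seq _ _ _ P C xs (n - size xs) wC) => [i|]; last by rewrite subn_gt0.
  by rewrite subnKC ?(ltnW lt_n) // -ysn; exact: ext_vanish_weak_regular.
exact/Pn/vxs.
Qed.

End CanonicalLocal.

Lemma canonical_local_surj (R : comPzRingType) (C1 C2 : lmodType R) :
  noetherian R -> cm_local_ring R -> canonical_module_local C1 ->
  canonical_module_local C2 ->
  exists f : {linear C1 -> C2}, forall y, exists u, f u = y.
Proof.
move=> Rn [m [lR [_ _ [d [Rdepth Rdim]]]]].
move=> [m1 [hm1 [lR1 [C1cm [d1' [C1d1 R1d1]]] type1 inj1]]].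
move=> [m2 [hm2 [lR2 [C2cm [d2' [C2d2 R2d2]]] type2 inj2]]].
have E1 : m1 = m by apply: lR.2.
have E2 : m2 = m by apply: lR.2.
subst m1 m2.
have lm := local_ring_max Rn lR.
have [C1fg C1nt [d1 [C1depth C1dim]]] := C1cm.
have [C2fg C2nt [d2 [C2depth C2dim]]] := C2cm.
have {C1dim C1d1 R1d1}d1E : d1 = d.
  by rewrite (krull_dim_unique C1dim C1d1) (krull_dim_unique R1d1 Rdim).
have {C2dim C2d2 R2d2}d2E : d2 = d.
  by rewrite (krull_dim_unique C2dim C2d2) (krull_dim_unique R2d2 Rdim).
subst d1 d2.
have [_ _ [P _]] := type1.
have vanish (M : lmodType R) : has_depth m M d -> forall i, (i < d)%N -> ext_vanish P M i.
  move=> [ys [<- /regular_seq_weak_regular wys ysm _]]; exact: ext_vanish_weak_regular.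
have Rfg : fin_gen R^o.
  exists [:: (1 : R^o)]; apply/seteqP; split=> // r _.
  have -> : r = (r : R) *: (1 : R^o) by rewrite /GRing.scale/= mulr1.
  by apply: smodZ; [exact: spanP|apply: spanS; rewrite /= inE].
have [|xs [xsd xsm [w1 w2 wR]]] := common_regular_seq (n := d) (P := P) Rn C1fg C2fg Rfg.
  by move=> i lt_i; split; apply: vanish.
have dimR k q : prime_chain R^o k q -> (k <= size xs)%N.
  by rewrite xsd; apply: Rdim.2.
have I1 := rel_inj_reduction Rn lR xsm wR dimR w1 inj1.
have I2 := rel_inj_reduction Rn lR xsm wR dimR w2 inj2.
have s1 := socle_reduction Rn lR xsm wR dimR C1fg C1nt w1 I1 type1.
have s2 := socle_reduction Rn lR xsm wR dimR C2fg C2nt w2 I2 type2.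
have ess := essential_socle Rn lR wR dimR.
have W1nt : ~ trivial_module (quot_seq C1 xs).
  by move=> W1t; apply: C1nt; exact: (quot_seq_nontrivial lm C1fg xsm W1t).
have [g gs] := rel_inj_socle_surj lm ess I1 I2 s1 s2 W1nt.
have [F [q [Ffg Fproj qs]]] := free_presentation C1fg.
pose K := submodule (ker_submodule q); pose i : {linear K -> F} := subincl (ker_submodule q).
have ii : injective i by exact: subincl_inj.
have ex : is_exact i q.
  move=> v; split=> [qv|[u ->]]; last exact: (subinclP u).
  by have [u uE] := subincl_surj (ker_submodule q) qv; exists u.
have Kfg : fin_gen K.
  have [s sE] := noeth_fin_gen Rn Ffg (ker_submodule q).
  have [t tE] : exists t : seq K, map i t = s.
    have : forall u, u \in s -> q u = 0.
      move=> u us; have : [set u | q u = 0] u by rewrite sE; exact: spanS.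
      by [].
    elim: (s) => [|u s' IH] H; first by exists [::].
    have [|t tE] := IH; first by move=> v vs; apply: H; rewrite inE vs orbT.
    have /ex[v vE] := H u (mem_head _ _).
    by exists (v :: t); rewrite /= tE -vE.
  exists t; apply/seteqP; split=> // k _.
  have : span [set` s] (i k) by rewrite -sE; exact: (subinclP k).
  move=> /(@span_least _ _ _ [set f | exists k, span [set` t] k /\ f = i k]).
  case=> [|f|k' [tk' /ii ->]] //.
    apply/is_submoduleP; split.
      by exists 0; rewrite linear0; split=> //; apply: smod0; exact: spanP.
    move=> a _ _ [u [tu ->]] [v [tv ->]]; exists (a *: u + v); rewrite linearP.
    by split=> //; apply: smodL => //; exact: spanP.
  rewrite -tE /= => /mapP[u ut ->]; exists u; split=> //; exact: spanS.
have ext : extends i (quot_seq C2 xs).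
  apply: (extend_rel_inj I2 _ ii qs ex w1) => [x w|]; first exact: quot_seq_killed.
  apply: (annihilator_cyclic_quot_seq (@cyclic_regular R)).
  exact: annihilator_regular.
have [f fE] := lift_quot_seq Rn lm Kfg Fproj qs ex C2fg xsm w2 ext
  [the {linear _ -> _} of g \o pi_seq C1 xs].
exists f => y.
suff : [set y | exists u, y = f u] y by move=> [u ->]; exists u.
apply: (nakayama_fg lm C2fg (image_submodule f)) => {}y.
(* Modulo [xs] the lift f is the surjection g, so y differs from a value of f by an element of
   (xs)C2, which lies in m C2. *)
have [v vE] := gs (pi_seq C2 xs y); have [u uE] := pi_seq_surj v.
exists (f u), (y - f u); split; first by exists u.
  have hm : is_ideal m by case: lm => -[].
  by apply: (pi_seq_eq0 hm xsm); rewrite linearB fE /= uE vE subrr.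
by rewrite addrC subrK.
Qed.

(** * Fractions, and descent from the localizations *)

Section Localization.
Variables (R : comPzRingType) (S : mulrClosed R).

Definition mkfrac (M : lmodType R) (u : M) (s : denom S) : locmod S M :=
  \pi_(locmod S M) (u, s).

Lemma mkfrac_surj (M : lmodType R) (y : locmod S M) : exists u s, y = mkfrac u s.
Proof. by elim/quotW: y => -[u s]; exists u, s. Qed.

Lemma mkfracZ (M : lmodType R) (a : R) (u : M) s t :
  ((mkfrac (a : R^o) s : locring S) *: mkfrac u t) = mkfrac (a *: u) (denomM s t).
Proof. exact: pi_loc_scale. Qed.

Lemma mkfrac_eq (M : lmodType R) (u v : M) s t :
  sval t *: u = sval s *: v -> mkfrac u s = mkfrac v t.
Proof. by move=> E; apply/eqP/loc_eqP; exists 1; rewrite ?rpred1 //= !mul1r. Qed.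

Lemma mkfrac_inj (M : lmodType R) (u v : M) s t : mkfrac u s = mkfrac v t ->
  exists2 r, r \in S & (r * sval t) *: u = (r * sval s) *: v.
Proof. by move=> /eqP/loc_eqP. Qed.

Lemma mkfracD (M : lmodType R) (u v : M) s :
  mkfrac (u + v) s = mkfrac u s + mkfrac v s.
Proof.
rewrite /mkfrac {2}/GRing.add/= -pi_loc_add; apply: mkfrac_eq => /=.
by rewrite -scalerDr !scalerA.
Qed.

Lemma mkfracL (M : lmodType R) (a : R) (u v : M) s :
  mkfrac (a *: u + v) s =
    (mkfrac (a : R^o) (denom1 S) : locring S) *: mkfrac u s + mkfrac v s.
Proof.
rewrite mkfracD mkfracZ; congr (_ + _); apply: mkfrac_eq => /=.
by rewrite mul1r.
Qed.

Lemma mkfrac0 (M : lmodType R) s : mkfrac (0 : M) s = 0.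
Proof. by apply: mkfrac_eq; rewrite !scaler0. Qed.

(** Every ideal of the localization is generated by the image of its contraction to R, since
    multiplying a fraction by its denominator stays in the ideal. *)
Lemma noetherian_locring : noetherian R -> noetherian (locring S).
Proof.
move=> Rn I hI; pose iota (a : R) : locring S := mkfrac (a : R^o) (denom1 S).
have iotaL c a b : iota (c *: (a : R^o) + b) = iota c * iota a + iota b.
  exact: mkfracL.
have hI0 : is_ideal [set a | I (iota a)].
  apply/is_submoduleP; split; first by rewrite /= /iota mkfrac0; exact: (idl0 hI).
  move=> c a b /= Ia Ib; rewrite iotaL.
  exact: (idlD hI (idlM hI (iota c) Ia) Ib).
have [t tE] := Rn _ hI0.
exists (map iota t); apply/seteqP; split; last first.
  apply: (@span_least _ (locring S)^o) => // _ /mapP[a at_ ->].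
  have : [set a | I (iota a)] a by rewrite tE; apply: (@spanS _ R^o).
  by [].
move=> y Iy; have [a [s yE]] := mkfrac_surj (M := R^o) y.
have hs := @spanP _ (locring S)^o [set` map iota t].
have : [set a | I (iota a)] a.
  have := idlM hI (iota (sval s)) Iy; rewrite /= yE; congr I.
  rewrite [LHS](@mkfracZ R^o); apply: mkfrac_eq => /=.
  by rewrite mul1r scale1r.
rewrite tE => ta.
have {}ta : @span _ (locring S)^o [set` map iota t] (iota a).
  move: ta; apply: (@span_least _ R^o _ [set a | @span _ (locring S)^o [set` map iota t] (iota a)]).
    apply/is_submoduleP; split; first by rewrite /= /iota mkfrac0; exact: smod0.
    by move=> c b b' /= hb hb'; rewrite iotaL; exact: (smodL (iota c) hs hb hb').
  by move=> b bt; apply: spanS; apply/mapP; exists b.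
have := smodZ (mkfrac (1 : R^o) s : locring S) hs ta; rewrite yE; congr (span _ _).
rewrite [LHS](@mkfracZ R^o); apply: mkfrac_eq => /=.
by rewrite mulr1 scale1r.
Qed.

(* the submodule S^-1 N of S^-1 M *)
Definition loc_sub (M : lmodType R) (N : set M) : set (locmod S M) :=
  [set y | exists u s, N u /\ y = mkfrac u s].

Lemma loc_subP (M : lmodType R) (N : set M) : is_submodule N ->
  @is_submodule (locring S) (locmod S M) (loc_sub N).
Proof.
move=> hN; apply/is_submoduleP; split.
  by exists 0, (denom1 S); rewrite mkfrac0; split=> //; exact: smod0.
move=> c _ _ [u [s [Nu ->]]] [v [t [Nv ->]]].
have [a [r ->]] := mkfrac_surj (M := R^o) c.
exists ((sval t * (a : R)) *: u + (sval r * sval s) *: v), (denomM (denomM r s) t).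
split; first by apply: smodL => //; exact: smodZ.
rewrite mkfracZ mkfracD; congr (_ + _); apply: mkfrac_eq => /=.
  by rewrite !scalerA; congr (_ *: _); ring.
by rewrite scalerA; congr (_ *: _); ring.
Qed.

Lemma loc_sub_descent (M : lmodType R) (N : set M) (u : M) s : is_submodule N ->
  loc_sub N (mkfrac u s) -> exists2 t, t \in S & N (t *: u).
Proof.
move=> hN [v [t [Nv /mkfrac_inj[r Sr E]]]].
exists (r * sval t); first by rewrite rpredM // denomP.
by rewrite E; exact: smodZ.
Qed.

End Localization.

Lemma ideal_exp_ideal (R : comPzRingType) (I : set R) k : is_ideal I ->
  is_ideal (ideal_exp I k).
Proof. by move=> hI; case: k => [|k]; [exact: (smodT R^o)|exact: smulP]. Qed.

(** The exponent k is the same for both modules, so the comparison is made before taking the union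
    over k. Membership in a submodule is local, and f carries the localization of I^(k+1) w1 into
    that of I^(k+1) w2. *)
Lemma colon_mono (A : comPzRingType) (A_noeth : noetherian A) (I : set A)
    (I_ideal : is_ideal I) (w1 w2 : lmodType A) (a : A) (k : nat) :
  (forall (m : set A) (hm : is_maximal m),
    exists f : {linear module_at (maximal_prime hm) w1 -> module_at (maximal_prime hm) w2},
    forall y, exists u, f u = y) ->
  colon (smul (ideal_exp I k.+1) [set: w1]) (smul (ideal_exp I k) [set: w1]) a ->
  colon (smul (ideal_exp I k.+1) [set: w2]) (smul (ideal_exp I k) [set: w2]) a.
Proof.
move=> loc_surj a1 u uk.
have hk : is_ideal (ideal_exp I k) by exact: ideal_exp_ideal.
have hk1 : is_ideal (ideal_exp I k.+1) by exact: ideal_exp_ideal.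
set N2 := smul _ _; have hN2 : is_submodule N2 by exact: smulP.
(* If a u is not in [N2], this ideal lies in a maximal m; but local membership at m produces an
   element of it outside m. *)
have hT : is_ideal [set t | N2 (t *: (a *: u))].
  apply/is_submoduleP; split; first by rewrite /= scale0r; exact: smod0.
  by move=> c t t' /= ht ht'; rewrite scalerDl -scalerA; exact: smodL.
apply: contrapT => nN2.
have [|m hm Tm] := exists_maximal A_noeth hT; first by rewrite /= scale1r.
have [f fs] := loc_surj m hm.
set S := prime_compl (maximal_prime hm).
have hL := loc_subP S hN2.
suff /loc_sub_descent[//|t St /Tm mt] : loc_sub N2 (mkfrac (a *: u) (denom1 S)).
  by move: St; rewrite unfold_in notin_setE.
have fL z s : smul (ideal_exp I k.+1) [set: w1] z -> loc_sub N2 (f (mkfrac z s : locmod S w1)).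
  apply: (@smul_least _ _ _ _ [set z | loc_sub N2 (f (mkfrac z s : locmod S w1))]).
    apply/is_submoduleP; split; first by rewrite /= mkfrac0 linear0; exact: smod0.
    by move=> r z1 z2 /= h1 h2; rewrite mkfracL linearP; exact: (smodL _ hL h1 h2).
  move=> c v Ic _ /=.
  have -> : mkfrac (c *: v) s = (mkfrac (c : A^o) (denom1 S) : locring S) *: mkfrac v s.
    by rewrite mkfracZ; apply: mkfrac_eq => /=; rewrite mul1r.
  rewrite linearZ /=; have [y [t ->]] := mkfrac_surj (f (mkfrac v s)).
  by rewrite mkfracZ; exists (c *: y), (denomM (denom1 S) t); split=> //; exact: smul_gen.
move: uk; apply: (@smul_least _ _ _ _ [set u | loc_sub N2 (mkfrac (a *: u) (denom1 S))]).
  apply/is_submoduleP; split; first by rewrite /= scaler0 mkfrac0; exact: smod0.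
  move=> r u1 u2 /= h1 h2; rewrite scalerDr scalerA mulrC -scalerA mkfracL.
  exact: (smodL _ hL h1 h2).
move=> b v Ib _ /=.
(* Surjectivity writes v/1 as f(v'/s), so a b v is the image of a b v'/s, to which the hypothesis on
   w1 applies. *)
have [y yE] := fs (mkfrac v (denom1 S)); have [v' [s yE']] := mkfrac_surj y.
have := fL (a *: (b *: v')) s (a1 _ (smul_gen Ib (Logic.I : [set: w1] v'))).
congr loc_sub.
have -> : mkfrac (a *: (b *: v')) s =
    (mkfrac ((a * b : A) : A^o) (denom1 S) : locring S) *: mkfrac v' s.
  by rewrite mkfracZ; apply: mkfrac_eq => /=; rewrite mul1r scalerA.
rewrite linearZ /= -yE' yE mkfracZ; apply: mkfrac_eq => /=.
by rewrite mul1r scalerA.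
Qed.

Theorem proposition3p1 (A : comPzRingType) (A_noeth : noetherian A)
    (A_cm : cohen_macaulay A) (I : set A) (I_ideal : is_ideal I)
    (w1 w2 : lmodType A) (w1_can : canonical_module w1)
    (w2_can : canonical_module w2) :
  r_ideal I w1 = r_ideal I w2.
Proof.
have sub v1 v2 : canonical_module v1 -> canonical_module v2 ->
    r_ideal I v1 `<=` r_ideal I v2.
  move=> [_ v1c] [_ v2c] a [k _ ak]; exists k => //.
  apply: (colon_mono A_noeth I_ideal _ ak) => m hm.
  apply: canonical_local_surj (v1c m hm) (v2c m hm); last exact: A_cm.
  exact: noetherian_locring.
by apply/seteqP; split; apply: sub.
Qed.
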